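(* Let $(Z_n)_{n\in\mathbb N}$ be a stationary Gaussian Markov process with zero mean and variance one. For every $k\in\mathbb N$ there are constants $C>0$ and $\beta\in[0,1)$ such that for all $i_1\le i_2\le\dots\le i_k$ with $n_j:=i_{j+1}-i_j$ and all $j_1\le\dots\le j_k$ with $d:=\min_{n,m\in\{1,\dots,k\}}|i_n-j_m|$ the following hold: $$|\mathbb E(Z_{i_1}Z_{i_2}\cdots Z_{i_k})|\le C\beta^{n_1+n_3+\dots+n_{k-1}}\quad\text{if }k\text{ is even},$$ $$|\mathbb E(Z_{i_1}Z_{i_2}\cdots Z_{i_k})|=0\quad\text{if }k\text{ is odd},$$ $$|\mathbb E(Z_{i_1}\cdots Z_{i_k}Z_{j_1}\cdots Z_{j_k})-\mathbb E(Z_{i_1}\cdots Z_{i_k})\,\mathbb E(Z_{j_1}\cdots Z_{j_k})|\le C\beta^{d}.$$ Moreover, for even $k$ and $d':=\min_{j=1,3,5,\dots}(i_{j+2}-i_j)$, $$|\mathbb E(Z_{i_1}^2Z_{i_3}^2\cdots Z_{i_{k-1}}^2)-1|\le C\beta^{d'}.$$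
   Context: All indices $i_1,\dots,i_k,j_1,\dots,j_k$ are natural numbers. In the definition of $d'$, $j$ runs over the odd numbers for which both $i_j$ and $i_{j+2}$ occur among $i_1,i_3,\dots,i_{k-1}$.
   Formalization: The process is additionally assumed to satisfy |Cov(Z_0,Z_1)| < 1; without this the claim is false, e.g. for the constant process Z_n = Z_0 (and for Z_n = (-1)^n Z_0), whose covariances do not decay. *)

(* Defs.v *)
From HB Require Import structures.
From mathcomp Require Import all_boot all_order all_algebra.
From mathcomp Require Import all_classical all_reals all_analysis.
Import Order.TTheory GRing.Theory Num.Theory.
Import numFieldNormedType.Exports.

Set Implicit Arguments.
Unset Strict Implicit.
Unset Printing Implicit Defensive.

Local Open Scope classical_set_scope.
Local Open Scope ring_scope.
Local Open Scope ereal_scope.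

Section Process.
Context (d : measure_display) (T : measurableType d) (R : realType).
Variable P : probability T R.

(* Point masses count as (degenerate) Gaussian laws; they are listed apart
   because [normal_prob m 0] is not a Dirac mass in the library. *)
Definition gaussian_rv (X : T -> R) : Prop :=
  (exists m s : R, (0 < s)%R /\
     forall A : set R, measurable A -> P (X @^-1` A) = normal_prob m s A) \/
  (exists m : R,
     forall A : set R, measurable A -> P (X @^-1` A) = \d_m A).

(* Every finite linear combination is Gaussian, i.e. all finite-dimensional
   distributions are multivariate normal. *)
Definition gaussian_process (Z : nat -> {RV P >-> R}) : Prop :=
  forall (n : nat) (a : nat -> R),
    gaussian_rv (fun w => (\sum_(0 <= l < n) a l * Z l w)%R).

Definition stationary (Z : nat -> {RV P >-> R}) : Prop :=
  forall (n : nat) (t : n.-tuple nat) (h : nat) (A : set (n.-tuple R)),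
    measurable A ->
    P ((fun w => [tuple Z (tnth t l + h)%N w | l < n]) @^-1` A) =
    P ((fun w => [tuple Z (tnth t l) w | l < n]) @^-1` A).

(* [Y] is a version of the conditional probability P(E | F), for a
   sub-sigma-algebra [F]. *)
Definition cond_prob_version (F : set (set T)) (E : set T) (Y : T -> R) :
    Prop :=
  [/\ P.-integrable setT (EFin \o Y),
      forall B : set R, measurable B -> F (Y @^-1` B)
    & forall B : set T, F B -> \int[P]_(w in B) (Y w)%:E = P (E `&` B)].

(* P(Z_{n+1} \in A | Z_0, ..., Z_n) = P(Z_{n+1} \in A | Z_n) almost surely:
   as versions are unique up to null sets, this says that the two conditional
   probabilities have a common version. *)
Definition markov_process (Z : nat -> {RV P >-> R}) : Prop :=
  forall (n : nat) (A : set R), measurable A ->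
    exists Y : T -> R,
      cond_prob_version
        (g_sigma_preimage (fun l : 'I_n.+1 => Z l : T -> R))
        (Z n.+1 @^-1` A) Y /\
      cond_prob_version
        (g_sigma_algebra_preimage (Z n)) (Z n.+1 @^-1` A) Y.

(* For a centred stationary Gaussian Markov process of variance one this
   excludes exactly Z_n = Z_0 and Z_n = (-1)^n Z_0 (almost surely), which have
   no decay of correlations. *)
Definition nondegenerate_process (Z : nat -> {RV P >-> R}) : Prop :=
  `|covariance P (Z 0%N) (Z 1%N)| < 1.

(* Index sequences are 1-based: only the values i 1, ..., i k matter. *)
Definition mixed (Z : nat -> {RV P >-> R}) (k : nat) (i : nat -> nat) : T -> R :=
  fun w => (\prod_(1 <= l < k.+1) Z (i l) w)%R.

Definition mixed_sq (Z : nat -> {RV P >-> R}) (k : nat) (i : nat -> nat) :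
    T -> R :=
  fun w => (\prod_(1 <= l < k.+1 | odd l) Z (i l) w ^+ 2)%R.

End Process.

Definition nondecr (k : nat) (i : nat -> nat) : Prop :=
  forall l, (1 <= l < k)%N -> (i l <= i l.+1)%N.

(* [None] stands for min \emptyset = +oo, with b ^ +oo = 0 for 0 <= b < 1. *)
Definition minseq (s : seq nat) : option nat :=
  if s is x :: s' then Some (foldr minn x s') else None.

Definition powo (R : realType) (b : R) (e : option nat) : R :=
  if e is Some n then (b ^+ n)%R else 0%R.

Definition gap_sum (k : nat) (i : nat -> nat) : nat :=
  (\sum_(1 <= l < k | odd l) (i l.+1 - i l))%N.

Definition dist_min (k : nat) (i j : nat -> nat) : option nat :=
  minseq [seq `|(i n)%:Z - (j m)%:Z|%N | n <- iota 1 k, m <- iota 1 k].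

Definition odd_gap_min (k : nat) (i : nat -> nat) : option nat :=
  minseq [seq (i l.+2 - i l)%N | l <- iota 1 k & odd l && (l.+2 < k)%N].

(* Main.v *)
Require Import Defs.
From HB Require Import structures.
From mathcomp Require Import all_boot all_order all_algebra.
From mathcomp Require Import all_classical all_reals all_analysis.
From mathcomp Require Import measurable_realfun ring lra zify.
Import Order.TTheory GRing.Theory Num.Theory.
Import numFieldNormedType.Exports.

Set Implicit Arguments.
Unset Strict Implicit.
Unset Printing Implicit Defensive.

Local Open Scope classical_set_scope.
Local Open Scope ring_scope.

(** A centred Gaussian process satisfies the Gaussian integration by parts
    formula: the moment of Z_u times a product of further variables is the sum,
    over these variables Z_x, of E(Z_u Z_x) times the moment of the remaining
    product [gaussian_ibp]. This recursion determines all mixed moments, and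
    it yields the four estimates: if |E(Z_x Z_y)| <= b ^ |x - y|, an induction
    on the list of indices bounds a moment by the cost of its cheapest pairing
    [wick_bound], makes odd moments vanish [wick_odd], and shows that the
    terms not respecting a splitting of the indices into two groups, or a
    doubling of each index, carry a factor b ^ d, where d is the distance that
    has to be bridged [wick_split], [wick_squares]. For an increasing list the
    cheapest pairing joins consecutive entries [gap_sum_le_parity].

    The recursion itself comes from one-dimensional laws only. A centred
    Gaussian variable V satisfies E(V^(n+1)) = n E(V^2) E(V^(n-1))
    [normal_centered_moment_rec], by integrating the derivative of a power
    times the density. Every V in the linear span of the process is of this
    kind, so the identity can be differentiated at t = 0 along V + t Z_x; each
    differentiation turns one factor V into a factor Z_x.

    It remains to see that E(Z_x Z_y) = rho ^ |x - y| with
    rho = E(Z_1 Z_0), which is smaller than 1 in absolute value by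
    nondegeneracy; this is where the Markov property enters. For l <= n the
    residual G = Z_l - E(Z_l Z_n) Z_n is orthogonal to every power of Z_n by
    the recursion, hence to every event generated by Z_n [orth_indic]: the
    square-exponential moment of Z_n lets the exponential series replace powers
    by Gaussian bumps exp(- N (Z_n - x)^2), and functions of these converge to
    indicators of intervals. The conditional probability of an event of Z_(n+1)
    given the past is a function of Z_n, so G is orthogonal to Z_(n+1) as well
    [markov_residual_orth], which says that
    E(Z_(n+1) Z_l) = E(Z_l Z_n) E(Z_(n+1) Z_n). *)

(** * Real-valued integrals *)

Lemma le_fact_expR (R : realType) n (y : R) :
  0 <= y -> y ^+ n <= n`!%:R * expR y.
Proof.
case: n => [|n] y0; first by rewrite expr0 fact0 mul1r -expR0 ler_expR.
have := expR_ge1Dxn n y0.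
rewrite -(ler_pM2l (_ : 0 < n.+1`!%:R)) ?ltr0n ?fact_gt0//.
by apply: le_trans; rewrite mulrDr mulr1 mulrCA divff ?mulr1 ?lerDr.
Qed.

Lemma norm_pow_le_expR_sqr (R : realType) p (c y : R) : 0 < c ->
  `|y| ^+ p <= 1 + (p`!%:R / c ^+ p) * expR (c * y ^+ 2).
Proof.
move=> c0; apply: (@le_trans _ _ (1 + (`|y| ^+ 2) ^+ p)).
  have [y1|/ltW y1] := leP `|y| 1.
    by rewrite -[leLHS]addr0 lerD ?exprn_ile1 ?exprn_ge0.
  rewrite -exprM -[leLHS]add0r lerD//.
  by rewrite ler_weXn2l// mul2n -addnn leq_addr.
rewrite lerD2l real_normK ?num_real//.
have cp : 0 < c ^+ p by rewrite exprn_gt0.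
rewrite mulrAC ler_pdivlMr// -exprMn mulrC.
by apply: le_fact_expR; rewrite mulr_ge0 ?sqr_ge0// ltW.
Qed.

Section RealIntegral.
Context (d : measure_display) (T : measurableType d) (R : realType).
Variable mu : {measure set T -> \bar R}.
Local Notation Rintegrable f := (mu.-integrable setT (EFin \o f)).
Local Notation E f := (Rintegral mu setT f).
Implicit Types f g : T -> R.

Lemma Rintegrable_measurable f : Rintegrable f -> measurable_fun setT f.
Proof. by move=> /(measurable_int mu)/measurable_EFinP. Qed.

Lemma RintegrableD f g : Rintegrable f -> Rintegrable g ->
  Rintegrable (fun w => f w + g w).
Proof. by move=> mf mg; exact: (integrableD measurableT mf mg). Qed.

Lemma RintegrableB f g : Rintegrable f -> Rintegrable g ->
  Rintegrable (fun w => f w - g w).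
Proof. by move=> mf mg; exact: (integrableB measurableT mf mg). Qed.

Lemma RintegrableZ c f : Rintegrable f -> Rintegrable (fun w => c * f w).
Proof. by move=> mf; exact: (integrableZl measurableT c mf). Qed.

Lemma Rintegrable_sum (I : Type) (s : seq I) (F : I -> T -> R) :
  (forall i, Rintegrable (F i)) -> Rintegrable (fun w => \sum_(i <- s) F i w).
Proof.
move=> iF; elim: s => [|i s IHs].
  under [X in EFin \o X]eq_fun do rewrite big_nil.
  exact: integrable0.
under [X in EFin \o X]eq_fun do rewrite big_cons.
exact: RintegrableD.
Qed.

Lemma Rintegral_sum (I : Type) (s : seq I) (F : I -> T -> R) :
  (forall i, Rintegrable (F i)) ->
  E (fun w => \sum_(i <- s) F i w) = \sum_(i <- s) E (F i).
Proof.
move=> iF; elim: s => [|i s IHs].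
  under [X in Rintegral _ _ X]eq_fun do rewrite big_nil.
  by rewrite big_nil Rintegral_cst// mul0r.
under [X in Rintegral _ _ X]eq_fun do rewrite big_cons.
rewrite big_cons RintegralD ?IHs//; exact: Rintegrable_sum.
Qed.

Lemma Rintegrable_le f g : measurable_fun setT f -> (forall w, `|f w| <= g w) ->
  Rintegrable g -> Rintegrable f.
Proof.
move=> mf fg ig; apply: (le_integrable measurableT _ _ ig).
  exact/measurable_EFinP.
by move=> w _ /=; rewrite lee_fin (le_trans (fg w))// ler_norm.
Qed.

Lemma Rintegral_dominated_cvg (f_ : nat -> T -> R) f g :
  (forall n, measurable_fun setT (f_ n)) -> measurable_fun setT f ->
  Rintegrable g -> (forall n w, `|f_ n w| <= g w) ->
  (forall w, f_ ^~ w @ \oo --> f w) ->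
  E (f_ n) @[n --> \oo] --> E f.
Proof.
move=> mf_ mf ig fg cf.
have [] := @dominated_convergence _ _ _ mu _ measurableT
  (fun n => EFin \o f_ n) (EFin \o f) (EFin \o g).
- by move=> n; exact/measurable_EFinP.
- exact/measurable_EFinP.
- by apply: aeW => w _; apply: cvg_EFin; [exact: nearW|exact: cf].
- exact: ig.
- by apply: aeW => w n _; rewrite lee_fin.
move=> if_ _ h; apply: fine_cvg; rewrite fineK//.
exact: integrable_fin_num if_.
Qed.

Lemma Rintegral_dominated_eq0 (f_ : nat -> T -> R) f g :
  (forall n, measurable_fun setT (f_ n)) -> measurable_fun setT f ->
  Rintegrable g -> (forall n w, `|f_ n w| <= g w) ->
  (forall w, f_ ^~ w @ \oo --> f w) ->
  (forall n, E (f_ n) = 0) -> E f = 0.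
Proof.
move=> mf_ mf ig fg cf f0.
have := Rintegral_dominated_cvg mf_ mf ig fg cf; under eq_fun do rewrite f0.
by move=> h; apply/esym; exact: (cvg_unique _ (cvg_cst _) h).
Qed.

(** Such functions form an algebra, on which expectations can be manipulated
    freely. *)
Definition all_moments f : Prop :=
  measurable_fun setT f /\ forall p : nat, Rintegrable (fun w => `|f w| ^+ p).

Lemma all_moments_int f : all_moments f -> Rintegrable f.
Proof.
move=> [mf /(_ 1%N)]; exact: Rintegrable_le.
Qed.

Lemma all_momentsM f g : all_moments f -> all_moments g ->
  all_moments (fun w => f w * g w).
Proof.
move=> [mf cf] [mg cg]; split=> [|p]; first exact: measurable_funM.
apply: (@Rintegrable_le _ (fun w => `|f w| ^+ (2 * p) + `|g w| ^+ (2 * p))).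
- by apply: measurable_funX; apply: measurableT_comp => //; exact: measurable_funM.
- move=> w; rewrite (ger0_norm (exprn_ge0 _ (normr_ge0 _))) normrM exprMn.
  rewrite mulnC !exprM.
  have := sqr_ge0 (`|f w| ^+ p - `|g w| ^+ p).
  have : 0 <= `|f w| ^+ p * `|g w| ^+ p by rewrite mulr_ge0.
  nra.
- exact: RintegrableD.
Qed.

Lemma all_moments_cst c : Rintegrable (cst 1 : T -> R) -> all_moments (fun=> c).
Proof.
move=> i1; split=> // p; have := RintegrableZ (`|c| ^+ p) i1.
by under eq_fun do rewrite /= mulr1.
Qed.

Lemma all_momentsZ c f : all_moments f -> all_moments (fun w => c * f w).
Proof.
move=> [mf cf]; split=> [|p]; first exact: measurable_funM.
under [X in EFin \o X]eq_fun do rewrite normrM exprMn.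
exact: RintegrableZ.
Qed.

Lemma all_momentsD f g : all_moments f -> all_moments g ->
  all_moments (fun w => f w + g w).
Proof.
move=> [mf cf] [mg cg]; split=> [|p]; first exact: measurable_funD.
apply: (@Rintegrable_le _ (fun w => 2 ^+ p * (`|f w| ^+ p + `|g w| ^+ p))).
- by apply: measurable_funX; apply: measurableT_comp => //; exact: measurable_funD.
- move=> w; rewrite ger0_norm ?exprn_ge0//.
  wlog fg : f g mf cf mg cg / `|g w| <= `|f w|.
    move=> h; have [|/ltW] := leP `|g w| `|f w|; first exact: h.
    by move=> gf; rewrite addrC [in leRHS]addrC; exact: h.
  apply: (@le_trans _ _ ((2 * `|f w|) ^+ p)).
    apply: lerXn2r; rewrite ?nnegrE ?mulr_ge0//.
    by apply: le_trans (ler_normD _ _) _; rewrite mulr2n mulrDl mul1r lerD2l.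
  by rewrite exprMn ler_wpM2l ?exprn_ge0// lerDl exprn_ge0.
- by apply: RintegrableZ; exact: RintegrableD.
Qed.

Lemma all_momentsB f g : all_moments f -> all_moments g ->
  all_moments (fun w => f w - g w).
Proof.
move=> cf cg; under eq_fun do rewrite -mulN1r.
by apply: all_momentsD => //; exact: all_momentsZ.
Qed.

Lemma all_momentsX f n : Rintegrable (cst 1 : T -> R) -> all_moments f ->
  all_moments (fun w => f w ^+ n).
Proof.
move=> i1 cf; elim: n => [|n IHn]; first exact: all_moments_cst.
by under eq_fun do rewrite exprS; exact: all_momentsM.
Qed.

Lemma all_moments_norm f : all_moments f -> all_moments (fun w => `|f w|).
Proof.
move=> [mf cf]; split=> [|p]; first exact: measurableT_comp.
by under [X in EFin \o X]eq_fun do rewrite normr_id.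
Qed.

Lemma all_moments_sum (I : Type) (s : seq I) (F : I -> T -> R) :
  Rintegrable (cst 1 : T -> R) ->
  (forall i, all_moments (F i)) -> all_moments (fun w => \sum_(i <- s) F i w).
Proof.
move=> i1 cF; elim: s => [|i s IHs].
  by under eq_fun do rewrite big_nil; exact: all_moments_cst.
by under eq_fun do rewrite big_cons; exact: all_momentsD.
Qed.

Lemma all_moments_prod (I : Type) (s : seq I) (F : I -> T -> R) :
  Rintegrable (cst 1 : T -> R) ->
  (forall i, all_moments (F i)) -> all_moments (fun w => \prod_(i <- s) F i w).
Proof.
move=> i1 cF; elim: s => [|i s IHs].
  by under eq_fun do rewrite big_nil; exact: all_moments_cst.
by under eq_fun do rewrite big_cons; exact: all_momentsM.
Qed.

(** The exponential series bounds every power by a square exponential. *)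
Lemma square_exp_all_moments c f : 0 < c -> measurable_fun setT f ->
  Rintegrable (cst 1 : T -> R) ->
  Rintegrable (fun w => expR (c * f w ^+ 2)) -> all_moments f.
Proof.
move=> c0 mf i1 ie; split=> // p.
apply: (@Rintegrable_le _ (fun w => 1 + (p`!%:R / c ^+ p) * expR (c * f w ^+ 2))).
- by apply: measurable_funX; apply: measurableT_comp.
- by move=> w; rewrite ger0_norm ?exprn_ge0//; exact: norm_pow_le_expR_sqr.
- by apply: RintegrableD => //; exact: RintegrableZ.
Qed.

End RealIntegral.

(** * Moments of the normal distribution *)

Section NormalMoments.
Context (R : realType) (m s : R).
Hypothesis s_gt0 : 0 < s.
Local Notation mu := (@lebesgue_measure R).
Local Notation N := (normal_prob m s).

Lemma ge0_integral_normal_prob (f : R -> R) : measurable_fun setT f ->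
  (forall x, 0 <= f x) ->
  (\int[N]_x (f x)%:E = \int[mu]_x (f x * normal_pdf m s x)%:E)%E.
Proof.
move=> mf f0; have dom := normal_prob_dominates m s.
rewrite -(Radon_Nikodym_SigmaFinite.change_of_variables dom)//; last first.
  exact/measurable_EFinP.
apply: ae_eq_integral => //.
- apply: emeasurable_funM; first exact/measurable_EFinP.
  exact: measurable_int (Radon_Nikodym_SigmaFinite.f_integrable dom).
- apply/measurable_EFinP; apply: measurable_funM => //.
  exact: measurable_normal_pdf.
- under [X in ae_eq _ _ _ X]eq_fun do rewrite EFinM.
  apply: ae_eqe_mul2l; apply: integral_ae_eq => //.
  + exact: Radon_Nikodym_SigmaFinite.f_integrable.
  + by apply/measurable_EFinP; exact: measurable_normal_pdf.
  + by move=> A _ mA; rewrite -Radon_Nikodym_SigmaFinite.f_integral.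
Qed.

Lemma integrable_normal_prob (f : R -> R) : measurable_fun setT f ->
  N.-integrable setT (EFin \o f) <->
  mu.-integrable setT (EFin \o (fun x => f x * normal_pdf m s x)).
Proof.
move=> mf.
have e : (\int[N]_x `|(f x)%:E| = \int[mu]_x `|(f x * normal_pdf m s x)%:E|)%E.
  under eq_integral do rewrite abse_EFin.
  rewrite ge0_integral_normal_prob//; last exact: measurableT_comp.
  apply: eq_integral => x _.
  by rewrite abse_EFin normrM (ger0_norm (normal_pdf_ge0 _ _ _)).
split=> /integrableP[_ h]; apply/integrableP; split.
- apply/measurable_EFinP; apply: measurable_funM => //.
  exact: measurable_normal_pdf.
- by rewrite -e.
- exact/measurable_EFinP.
- by rewrite e.
Qed.

Lemma Rintegral_normal_prob (f : R -> R) : measurable_fun setT f ->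
  N.-integrable setT (EFin \o f) ->
  Rintegral N setT f = Rintegral mu setT (fun x => f x * normal_pdf m s x).
Proof.
move=> mf nf; have nf' := Rintegrable_measurable nf.
have nn : N.-integrable setT (EFin \o (fun x => `|f x|)) by exact: integrable_norm.
have mn : measurable_fun setT (fun x => `|f x|) by exact: measurableT_comp.
have ns := RintegrableD nn nf.
have -> : f = (fun x => (`|f x| + f x) - `|f x|).
  by apply/funext => x; rewrite addrAC subrr add0r.
rewrite RintegralB//.
under [in RHS]eq_Rintegral do rewrite mulrBl.
have ms : measurable_fun setT (fun x => `|f x| + f x) by exact: measurable_funD.
rewrite RintegralB//; [|exact/integrable_normal_prob..].
congr (_ - _); rewrite /Rintegral ge0_integral_normal_prob// => x.
by rewrite addrC -[X in _ + X]opprK subr_ge0 lerNl -normrN ler_norm.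
Qed.

(** The rate 3 / (8 s^2) is below the critical 1 / (2 s^2) and turns the density
    of deviation [s] into a multiple of the density of deviation [2 * s]. *)
Lemma integrable_normal_exp_sqr :
  N.-integrable setT (EFin \o (fun x => expR (3 / (8 * s ^+ 2) * (x - m) ^+ 2))).
Proof.
have s0 : s != 0 by rewrite gt_eqF.
have me : measurable_fun setT (fun x : R => expR (3 / (8 * s ^+ 2) * (x - m) ^+ 2)).
  apply: measurableT_comp => //; apply: measurable_funM => //.
  by apply: measurable_funX; exact: measurable_funB.
apply/integrable_normal_prob => //.
have s2 : 2 * s != 0 by rewrite mulf_neq0.
rewrite (_ : (fun x => _) = (fun x =>
   (normal_peak s / normal_peak (2 * s)) * normal_pdf m (2 * s) x)).
  by apply: RintegrableZ; exact: integrable_normal_pdf.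
apply/funext => x; rewrite !normal_pdfE// mulrA divfK; last first.
  by rewrite gt_eqF// normal_peak_gt0.
rewrite mulrCA; congr (_ * _); rewrite /normal_fun -expRD; congr expR.
by field.
Qed.

Lemma normal_centered_all_moments : all_moments N (fun x => x - m).
Proof.
apply: (@square_exp_all_moments _ _ _ _ (3 / (8 * s ^+ 2))).
- by rewrite divr_gt0 ?mulr_gt0 ?exprn_gt0.
- exact: measurable_funB.
- exact: finite_measure_integrable_cst.
- exact: integrable_normal_exp_sqr.
Qed.

Let g (n : nat) (x : R) := (x - m) ^+ n * normal_pdf m s x.

Let g_int n : mu.-integrable setT (EFin \o g n).
Proof.
apply/integrable_normal_prob.
  by apply: measurable_funX; exact: measurable_funB.
apply: all_moments_int; apply: all_momentsX.
  exact: finite_measure_integrable_cst.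
exact: normal_centered_all_moments.
Qed.

Lemma is_derive_normal_fun (x : R) :
  is_derive x (1 : R) (normal_fun m s) (- (x - m) / s ^+ 2 * normal_fun m s x).
Proof.
have s0 : s != 0 by rewrite gt_eqF.
pose h := fun x : R => - (x - m) ^+ 2 / (s ^+ 2 *+ 2).
have hh : is_derive x (1 : R) h (- (x - m) / s ^+ 2).
  have -> : h = (- (s ^+ 2 *+ 2)^-1) *: ((id - cst m) ^+ 2).
    by apply/funext => z; rewrite /h !fctE/= mulNr mulrC -mulNr.
  apply: is_derive_eq; rewrite /= !fctE subr0.
  rewrite /GRing.scale/=.
  by field.
by rewrite mulrC; exact: (is_derive1_comp (is_derive_expR (h x)) hh).
Qed.

Let dg n x := n%:R * g n.-1 x - (s ^+ 2)^-1 * g n.+1 x.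

Let is_derive_g n (x : R) : is_derive x (1 : R) (g n) (dg n x).
Proof.
have s0 : s != 0 by rewrite gt_eqF.
have hn := is_derive_normal_fun x.
have -> : g n = normal_peak s *: ((id - cst m) ^+ n * normal_fun m s).
  apply/funext => z; rewrite /g normal_pdfE// !fctE /GRing.scale/=.
  by rewrite mulrCA.
apply: is_derive_eq; rewrite /= /dg /g normal_pdfE// !fctE subr0 /GRing.scale/=.
by rewrite (exprS (x - m)); field.
Qed.

Let continuous_g n : continuous (g n).
Proof.
move=> x; apply/differentiable_continuous/derivable1_diffP.
by have [] := is_derive_g n x.
Qed.

Let continuous_dg n : continuous (dg n).
Proof.
move=> x; apply: cvgB; (apply: cvgM; [exact: cvg_cst|exact: continuous_g]).
Qed.

Let g_FTC n (a b : R) : a < b -> Rintegral mu `[a, b] (dg n) = g n b - g n a.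
Proof.
move=> ab; rewrite /Rintegral (@continuous_FTC2 _ _ (g n))//.
- exact/continuous_subspaceT/continuous_dg.
- split.
  + by move=> x _; have [] := is_derive_g n x.
  + exact/cvg_at_right_filter/continuous_g.
  + exact/cvg_at_left_filter/continuous_g.
- by move=> x _; rewrite derive1E; have [_ ->] := is_derive_g n x.
Qed.

Let g_decay n : exists C, forall y, `|y| * `|g n (m + y)| <= C.
Proof.
have s0 : s != 0 by rewrite gt_eqF.
pose c := (s ^+ 2 *+ 2)^-1.
have c0 : 0 < c by rewrite invr_gt0 pmulrn_lgt0// exprn_gt0.
exists (normal_peak s * (1 + n.+1`!%:R / c ^+ n.+1)) => y.
rewrite /g normal_pdfE// addrAC subrr add0r normrM mulrA normrX -exprS.
rewrite (ger0_norm (mulr_ge0 (normal_peak_ge0 _) (normal_fun_ge0 _ _ _))).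
rewrite mulrCA ler_wpM2l ?normal_peak_ge0//.
have -> : normal_fun m s (m + y) = expR (- (c * y ^+ 2)).
  rewrite /normal_fun /c; congr expR; rewrite addrAC subrr add0r.
  by rewrite mulNr mulrC.
apply: le_trans (ler_wpM2r (expR_ge0 _) (norm_pow_le_expR_sqr n.+1 y c0)) _.
rewrite mulrDl mul1r -[X in _ + X <= _]mulrA -expRD subrr expR0 mulr1 lerD2r.
by rewrite -expR0 ler_expR oppr_le0 mulr_ge0 ?sqr_ge0// ltW.
Qed.

(* dg n is the derivative of g n, which vanishes at both ends of the line *)
Let E_dg n : Rintegral mu setT (dg n) = 0.
Proof.
have idg : mu.-integrable setT (EFin \o dg n) by apply: RintegrableB; exact: RintegrableZ.
pose I (k : nat) : set R := `[m - k.+1%:R, m + k.+1%:R]%classic.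
have mdg := Rintegrable_measurable idg.
have h1 : Rintegral mu setT (dg n \_ (I k)) @[k --> \oo] -->
    Rintegral mu setT (dg n).
  apply: (@Rintegral_dominated_cvg _ _ _ mu _ _ (fun x => `|dg n x|)) => //.
  - move=> k; apply/(measurable_restrictT (dg n)).
    + exact: measurable_itv.
    + exact: measurable_funTS.
  - exact: integrable_norm.
  - by move=> k x; rewrite patchE; case: ifP => // _; rewrite normr0.
  - move=> x; apply: cvg_near_cst; near=> k.
    rewrite patchE mem_set// /I /= in_itv/= -ler_distlC.
    near: k; apply: filterS (nbhs_infty_ger `|x - m|) => k.
    by rewrite distrC => /le_trans; apply; rewrite ler_nat.
have [C hC] := g_decay n.
have h2 : Rintegral mu setT (dg n \_ (I k)) @[k --> \oo] --> (0 : R).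
  apply: (@squeeze_cvgr _ _ _ _ (fun k : nat => - (2 * C) * k.+1%:R^-1)
    (fun k : nat => 2 * C * k.+1%:R^-1)).
  - near=> k; rewrite -Rintegral_mkcond g_FTC; last first.
      by rewrite ltrD2l gtrN.
    have k0 : 0 < k.+1%:R :> R by [].
    have bnd y : `|y| = k.+1%:R -> `|g n (m + y)| <= C * k.+1%:R^-1.
      by move=> yk; rewrite ler_pdivlMr// mulrC -yk.
    have := bnd k.+1%:R (ger0_norm (ltW k0)).
    have := bnd (- k.+1%:R); rewrite normrN (ger0_norm (ltW k0)) => /(_ erefl).
    rewrite !ler_norml mulNr -mulrA.
    move: (g n _) (g n _) (C / _) => u v w; lra.
  - rewrite -[X in _ --> X](mulr0 (- (2 * C))).
    by apply: cvgMr; exact: cvg_harmonic.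
  - rewrite -[X in _ --> X](mulr0 (2 * C)).
    by apply: cvgMr; exact: cvg_harmonic.
exact: (cvg_unique _ h1 h2).
Unshelve. all: by end_near. Qed.

(** The derivative of [(x - m) ^+ n] times the density integrates to zero. *)
Lemma normal_centered_moment_rec n :
  Rintegral N setT (fun x => (x - m) ^+ n.+1) =
  s ^+ 2 * (n%:R * Rintegral N setT (fun x => (x - m) ^+ n.-1)).
Proof.
have s0 : s != 0 by rewrite gt_eqF.
have h k : Rintegral N setT (fun x => (x - m) ^+ k) = Rintegral mu setT (g k).
  rewrite Rintegral_normal_prob//.
    by apply: measurable_funX; exact: measurable_funB.
  apply: all_moments_int; apply: all_momentsX.
    exact: finite_measure_integrable_cst.
  exact: normal_centered_all_moments.
rewrite !h; have := E_dg n; rewrite RintegralB//; [|exact: RintegrableZ..].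
rewrite !RintegralZl// => /eqP; rewrite subr_eq0 => /eqP ->.
by rewrite mulrA divff ?mul1r// expf_neq0.
Qed.

End NormalMoments.

(** * Gaussian variables *)

Section LawTransfer.
Context (d : measure_display) (T : measurableType d) (R : realType).
Variable P : probability T R.

Lemma law_transfer (d' : measure_display) (T' : measurableType d')
    (X : {mfun T >-> T'}) (Q : {measure set T' -> \bar R}) (f : T' -> R) :
  (forall A : set T', measurable A -> P (X @^-1` A) = Q A) ->
  measurable_fun setT f -> Q.-integrable setT (EFin \o f) ->
  P.-integrable setT (EFin \o (f \o X)) /\
  Rintegral P setT (f \o X) = Rintegral Q setT f.
Proof.
move=> PQ mf iQ.
have mfX : measurable_fun setT (f \o X) by exact: measurableT_comp.
have e (h : T' -> \bar R) : (forall x, 0 <= h x)%E -> measurable_fun setT h ->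
    (\int[P]_w h (X w) = \int[Q]_x h x)%E.
  move=> h0 mh; rewrite -(@ge0_integral_distribution _ _ _ _ _ P X)//.
  by apply: eq_measure_integral => A mA _; rewrite /= /distribution /pushforward PQ.
have iP : P.-integrable setT (EFin \o (f \o X)).
  apply/integrableP; split; first exact/measurable_EFinP.
  rewrite (e (fun x => `|(f x)%:E|%E))//; first by case/integrableP : iQ.
  by apply: measurableT_comp => //; exact/measurable_EFinP.
split => //; rewrite /Rintegral; congr fine.
rewrite -(@integral_distribution _ _ _ _ _ P X (EFin \o f))//; last first.
  exact/measurable_EFinP.
by apply: eq_measure_integral => A mA _; rewrite /= /distribution /pushforward PQ.
Qed.

Lemma eq_law_expectation (X Y : {mfun T >-> R}) :
  (forall A : set R, measurable A -> P (X @^-1` A) = P (Y @^-1` A)) ->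
  P.-integrable setT (EFin \o Y) ->
  Rintegral P setT X = Rintegral P setT Y.
Proof.
move=> XY iY.
have mid : measurable_fun setT (EFin : R -> \bar R).
  exact/measurable_EFinP/measurable_id.
have h : (distribution P Y).-integrable setT (EFin \o (@id R)).
  exact: integrable_pushforward.
have mid' := @measurable_id _ R setT.
have [_ ->] := @law_transfer _ _ X (distribution P Y) _ XY mid' h.
by rewrite /Rintegral integral_distribution.
Qed.

End LawTransfer.

Section GaussianVariable.
Context (d : measure_display) (T : measurableType d) (R : realType).
Variable P : probability T R.
Local Notation E f := (Rintegral P setT f).

Let i1 : P.-integrable setT (EFin \o (cst 1 : T -> R)).
Proof. exact: finite_measure_integrable_cst. Qed.

(** A point mass is the case [v = 0] of the moment recursion of normal laws, so
    both kinds of Gaussian law can be treated at once. *)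
Lemma gaussian_law (V : T -> R) : gaussian_rv P V ->
  exists (Q : probability (measurableTypeR R) R) (m v : R),
  [/\ forall A : set R, measurable A -> P (V @^-1` A) = Q A,
      all_moments Q (fun x => x - m),
      forall n, Rintegral Q setT (fun x => (x - m) ^+ n.+1) =
        v * (n%:R * Rintegral Q setT (fun x => (x - m) ^+ n.-1))
    & 0 < v ->
      Q.-integrable setT (EFin \o (fun x => expR (3 / (8 * v) * (x - m) ^+ 2)))].
Proof.
move=> [[m [s [s0 law]]]|[m law]].
  exists (normal_prob m s : probability _ _), m, (s ^+ 2); split => //.
  - exact: normal_centered_all_moments.
  - by move=> n; exact: normal_centered_moment_rec.
  - by move=> _; exact: integrable_normal_exp_sqr.
exists (@dirac _ (measurableTypeR R) m R : probability (measurableTypeR R) R).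
exists m, 0; split => //.
- split=> [|p]; first exact: measurable_funB.
  apply/integrableP; split.
    apply/measurable_EFinP; apply: measurable_funX.
    by apply: measurableT_comp => //; exact: measurable_funB.
  rewrite integral_dirac//=; last first.
    do 2 apply: measurableT_comp => //.
    apply: measurable_funX.
    by apply: measurableT_comp => //; exact: measurable_funB.
  by rewrite diracT mul1e ltry.
- move=> n; rewrite mul0r /Rintegral integral_dirac//=; last first.
    apply/measurable_EFinP; apply: measurable_funX.
    exact: measurable_funB.
  by rewrite subrr expr0n mulr0.
- by rewrite ltxx.
Qed.

Lemma gaussian_all_moments (V : T -> R) : measurable_fun setT V ->
  gaussian_rv P V -> all_moments P V.
Proof.
move=> mV /gaussian_law[Q [m [v [law am _ _]]]].
have mV' : @measurable_fun _ _ _ (measurableTypeR R) setT V by exact: mV.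
pose X : {mfun T >-> measurableTypeR R} :=
  HB.pack (V : T -> measurableTypeR R) (isMeasurableFun.Build _ _ _ _ _ mV').
have -> : V = (fun w => (V w - m) + m) by apply/funext => w; rewrite subrK.
apply: all_momentsD; last exact: all_moments_cst.
split=> [|p]; first exact: measurable_funB.
have [mf /(_ p) ip] := am.
apply: (@law_transfer _ _ _ P _ _ X Q (fun x => `|x - m| ^+ p) law _ ip).1.
by apply: measurable_funX; exact: measurableT_comp.
Qed.

(** A vanishing mean forces the centre [m] of the law to be 0, and then the
    case [n = 1] of the recursion identifies its parameter with the second
    moment. *)
Lemma centered_gaussian_law (V : T -> R) : measurable_fun setT V ->
  gaussian_rv P V -> E V = 0 ->
  (forall n, E (fun w => V w ^+ n.+1) =
     E (fun w => V w ^+ 2) * (n%:R * E (fun w => V w ^+ n.-1))) /\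
  (0 < E (fun w => V w ^+ 2) ->
   P.-integrable setT
     (EFin \o (fun w => expR (3 / (8 * E (fun w => V w ^+ 2)) * V w ^+ 2)))).
Proof.
move=> mV gV EV0; have aV := gaussian_all_moments mV gV.
have [Q [m [v [law am rec ex]]]] := gaussian_law gV.
have mV' : @measurable_fun _ _ _ (measurableTypeR R) setT V by exact: mV.
pose X : {mfun T >-> measurableTypeR R} :=
  HB.pack (V : T -> measurableTypeR R) (isMeasurableFun.Build _ _ _ _ _ mV').
have q1 : Q.-integrable setT (EFin \o (cst 1 : R -> R)).
  exact: finite_measure_integrable_cst.
have tr n : E (fun w => (V w - m) ^+ n) = Rintegral Q setT (fun x => (x - m) ^+ n).
  apply: (@law_transfer _ _ _ P _ _ X Q (fun x => (x - m) ^+ n) law _ _).2.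
    by apply: measurable_funX; exact: measurable_funB.
  by apply: all_moments_int; exact: all_momentsX.
have Ec c : E (fun=> c) = c.
  by rewrite Rintegral_cst// (congr1 fine (probability_setT P)) mulr1.
have m0 : m = 0.
  have := rec 0%N; rewrite mul0r mulr0 -tr.
  under eq_Rintegral do rewrite expr1.
  rewrite RintegralB//; last 2 first.
  - exact: all_moments_int.
  - exact: finite_measure_integrable_cst.
  by rewrite EV0 Ec sub0r => /eqP; rewrite oppr_eq0 => /eqP.
move: rec tr ex; rewrite m0 => rec tr ex.
have {}tr n : Rintegral Q setT (fun x => (x - 0) ^+ n) = E (fun w => V w ^+ n).
  by rewrite -tr; apply: eq_Rintegral => w _; rewrite subr0.
have vE : E (fun w => V w ^+ 2) = v.
  rewrite -tr rec tr; under eq_Rintegral do rewrite expr0.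
  by rewrite Ec !mulr1.
rewrite vE; split=> [n|v0]; first by rewrite -tr rec tr.
have mf : measurable_fun setT (fun x : R => expR (3 / (8 * v) * (x - 0) ^+ 2)).
  apply: measurableT_comp => //; apply: measurable_funM => //.
  by apply: measurable_funX; exact: measurable_funB.
have := (@law_transfer _ _ _ P _ _ X Q _ law mf (ex v0)).1.
by apply: eq_integrable => // w _ /=; rewrite subr0.
Qed.

End GaussianVariable.

(** * Gaussian integration by parts *)

Section GaussianProcess.
Context (d : measure_display) (T : measurableType d) (R : realType).
Variables (P : probability T R) (Z : nat -> {RV P >-> R}).
Local Notation E f := (Rintegral P setT f).
Hypothesis gaussZ : gaussian_process Z.
Hypothesis meanZ : forall n, E (Z n) = 0.

Let i1 : P.-integrable setT (EFin \o (cst 1 : T -> R)).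
Proof. exact: finite_measure_integrable_cst. Qed.

Lemma Rintegral_prob_cst (c : R) : E (fun=> c) = c.
Proof. by rewrite Rintegral_cst// (congr1 fine (probability_setT P)) mulr1. Qed.

Definition gaussian_span (V : T -> R) : Prop :=
  exists (n : nat) (a : nat -> R), V = fun w => \sum_(0 <= l < n) a l * Z l w.

Lemma gaussian_spanD V t x : gaussian_span V ->
  gaussian_span (fun w => V w + t * Z x w).
Proof.
move=> [n [a ->]]; exists (maxn n x.+1).
exists (fun l => (if (l < n)%N then a l else 0) + (if l == x then t else 0)).
apply/funext => w; under [RHS]eq_bigr do rewrite mulrDl.
rewrite big_split /=; congr (_ + _).
  rewrite [RHS](big_cat_nat _ (n := n))//= ?leq_maxl//.
  rewrite [X in _ + X]big_nat_cond [X in _ + X]big1 ?addr0; last first.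
    by move=> l /andP[/andP[nl _] _]; rewrite ltnNge nl mul0r.
  by rewrite big_nat [RHS]big_nat; apply: eq_bigr => l /andP[_ ->].
rewrite (bigD1_seq x)/= ?iota_uniq ?mem_index_iota ?leq_maxr//.
by rewrite eqxx big1 ?addr0// => l /negPf ->; rewrite mul0r.
Qed.

Lemma gaussian_span0 : gaussian_span (fun=> 0).
Proof.
by exists 0%N, (fun=> 0); apply/funext => w; rewrite big_geq.
Qed.

Lemma gaussian_spanZ x : gaussian_span (Z x).
Proof.
rewrite (_ : (Z x : T -> R) = (fun w => 0 + 1 * Z x w)).
  exact/gaussian_spanD/gaussian_span0.
by apply/funext => w; rewrite mul1r add0r.
Qed.

Lemma all_moments_Z x : all_moments P (Z x).
Proof.
apply: gaussian_all_moments => //.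
have [n [a ->]] := gaussian_spanZ x.
exact: gaussZ.
Qed.

Lemma all_moments_span V : gaussian_span V -> all_moments P V.
Proof.
move=> [n [a ->]]; apply: all_moments_sum => // l.
exact/all_momentsZ/all_moments_Z.
Qed.

Lemma mean_span V : gaussian_span V -> E V = 0.
Proof.
move=> [n [a ->]]; rewrite Rintegral_sum; last first.
  by move=> l; exact/RintegrableZ/all_moments_int/all_moments_Z.
apply: big1 => l _; rewrite RintegralZl ?meanZ ?mulr0//.
exact/all_moments_int/all_moments_Z.
Qed.

Lemma span_moment_rec V n : gaussian_span V ->
  E (fun w => V w ^+ n.+1) =
  E (fun w => V w ^+ 2) * (n%:R * E (fun w => V w ^+ n.-1)).
Proof.
move=> sV; have [mV _] := all_moments_span sV.
apply: (centered_gaussian_law mV _ (mean_span sV)).1.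
by case: sV => k [a ->]; exact: gaussZ.
Qed.

Lemma span_exp_sqr V : gaussian_span V -> E (fun w => V w ^+ 2) = 1 ->
  P.-integrable setT (EFin \o (fun w => expR (3 / 8 * V w ^+ 2))).
Proof.
move=> sV V1; have [mV _] := all_moments_span sV.
have := (centered_gaussian_law mV _ (mean_span sV)).2.
rewrite V1 mulr1; apply => //.
by case: sV => k [a ->]; exact: gaussZ.
Qed.

(** The function is a polynomial in [t], whose linear coefficient is read off
    from the binomial formula. *)
Lemma is_derive_Rintegral_pow (A V X : T -> R) n :
  all_moments P A -> all_moments P V -> all_moments P X ->
  is_derive (0 : R) (1 : R) (fun t => E (fun w => A w * (V w + t * X w) ^+ n))
    (n%:R * E (fun w => A w * (V w ^+ n.-1 * X w))).
Proof.
move=> aA aV aX.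
pose c i := E (fun w => A w * (V w ^+ (n - i) * X w ^+ i)) *+ 'C(n, i).
have ai i : all_moments P (fun w => A w * (V w ^+ (n - i) * X w ^+ i)).
  by apply: all_momentsM => //; apply: all_momentsM; exact: all_momentsX.
have -> : (fun t => E (fun w => A w * (V w + t * X w) ^+ n)) =
    horner (\poly_(i < n.+1) c i).
  apply/funext => t; rewrite horner_poly.
  transitivity (E (fun w => \sum_(i < n.+1)
      (t ^+ i *+ 'C(n, i)) * (A w * (V w ^+ (n - i) * X w ^+ i)))).
    apply: eq_Rintegral => w _; rewrite exprDn mulr_sumr; apply: eq_bigr => i _.
    rewrite exprMn mulrnAr mulrnAl; congr (_ *+ _).
    by move: (A w) (V w ^+ _) (t ^+ _) (X w ^+ _) => p q u v; ring.
  rewrite Rintegral_sum; last by move=> i; exact/RintegrableZ/all_moments_int.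
  apply: eq_bigr => i _; rewrite RintegralZl//; last exact: all_moments_int.
  by rewrite /c !mulrnAl mulrC.
have -> : n%:R * E (fun w => A w * (V w ^+ n.-1 * X w)) =
    (\poly_(i < n.+1) c i)^`().[0].
  rewrite horner_coef0 coef_deriv coef_poly /c; clear c ai.
  case: n => [|n]; first by rewrite mul0r mul0rn.
  rewrite /= mulr1n bin1 subSS subn0 mulr_natl.
  by under [in RHS]eq_Rintegral do rewrite expr1.
exact: is_derive_poly.
Qed.

Lemma is_derive_unique (f : R -> R) (x a b : R) :
  is_derive x (1 : R) f a -> is_derive x (1 : R) f b -> a = b.
Proof. by move=> [_ <-] [_ <-]. Qed.

(** Differentiating E(V^(n+1)) = n E(V^2) E(V^(n-1)) along [V + t * Z u]
    expresses E(Z_u V^n) through E(Z_u V^(n-2)), whence the two-step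
    induction. *)
Lemma gaussian_ibp_pow u V n : gaussian_span V ->
  E (fun w => Z u w * V w ^+ n) =
  n%:R * (E (fun w => Z u w * V w) * E (fun w => V w ^+ n.-1)).
Proof.
move=> sV.
have aV := all_moments_span sV; have aZ := all_moments_Z u.
have a1 : all_moments P (fun=> 1 : R) by exact: all_moments_cst.
have aVn k : all_moments P (fun w => V w ^+ k) by exact: all_momentsX.
have [m] := ubnP n; elim: m n => // m IHm [|[|n]] nm.
- rewrite mul0r -(meanZ u); apply: eq_Rintegral => w _.
  by rewrite expr0 mulr1.
- rewrite mul1r; under [X in _ * X]eq_Rintegral do rewrite expr0.
  by rewrite Rintegral_prob_cst mulr1; apply: eq_Rintegral => w _; rewrite expr1.
pose F k t := E (fun w => 1 * (V w + t * Z u w) ^+ k).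
have dF k : is_derive (0 : R) (1 : R) (F k)
    (k%:R * E (fun w => Z u w * V w ^+ k.-1)).
  rewrite (_ : E _ = E (fun w => 1 * (V w ^+ k.-1 * Z u w))); last first.
    by apply: eq_Rintegral => w _; rewrite mul1r mulrC.
  exact: is_derive_Rintegral_pow.
have F0 k : F k 0 = E (fun w => V w ^+ k).
  by apply: eq_Rintegral => w _; rewrite mul1r mul0r addr0.
have FE : F n.+3 = F 2%N * (n.+2%:R *: F n.+1).
  apply/funext => t; rewrite !fctE /GRing.scale/= /F.
  under eq_Rintegral do rewrite mul1r.
  under [X in _ = X * _]eq_Rintegral do rewrite mul1r.
  under [X in _ = _ * (_ * X)]eq_Rintegral do rewrite mul1r.
  by rewrite span_moment_rec//; exact: gaussian_spanD.
have dG : is_derive (0 : R) (1 : R) (F 2%N * (n.+2%:R *: F n.+1))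
    (F 2%N 0 *: (n.+2%:R *: (n.+1%:R * E (fun w => Z u w * V w ^+ n)))
     + (n.+2%:R *: F n.+1) 0 *: (2%:R * E (fun w => Z u w * V w ^+ 1))).
  exact: is_deriveM.
have := dF n.+3; rewrite FE => dF3; have := is_derive_unique dF3 dG.
rewrite !fctE /GRing.scale/= !F0 (IHm n); last by lia.
under [X in 2%:R * X]eq_Rintegral do rewrite expr1.
rewrite (span_moment_rec n sV).
set a := E _; set b := E _; set c := E _; set e := E (fun w => V w ^+ n.-1).
move=> h; apply: (@mulfI _ (n.+3%:R)); first by rewrite pnatr_eq0.
rewrite h -!natr1; ring.
Qed.

Local Notation cov x y := (E (fun w => Z x w * Z y w)).

(** Polarisation of [gaussian_ibp_pow]: an index [a] is added to [s] by
    differentiating the formula for [n.+1] at [t = 0] along [V + t * Z a], which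
    turns one factor [V] into a factor [Z a]. The remaining powers of [V] are
    what keeps the induction going. *)
Lemma gaussian_ibp u s V n : gaussian_span V ->
  E (fun w => Z u w * ((\prod_(x <- s) Z x w) * V w ^+ n)) =
  \sum_(x <- s) cov u x * E (fun w => (\prod_(y <- rem x s) Z y w) * V w ^+ n)
  + n%:R * (E (fun w => Z u w * V w) *
            E (fun w => (\prod_(x <- s) Z x w) * V w ^+ n.-1)).
Proof.
have ap (l : seq nat) : all_moments P (fun w => \prod_(x <- l) Z x w).
  by apply: all_moments_prod => // x; exact: all_moments_Z.
elim: s V n => [|a s IHs] V n sV.
  rewrite big_nil add0r; under eq_Rintegral do rewrite big_nil mul1r.
  rewrite gaussian_ibp_pow//; congr (_ * (_ * _)).
  by apply: eq_Rintegral => w _; rewrite big_nil mul1r.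
have aV := all_moments_span sV; have aZ x := all_moments_Z x.
pose B (l : seq nat) w : R := \prod_(x <- l) Z x w.
pose F l k t := E (fun w => B l w * (V w + t * Z a w) ^+ k).
have dF l k : is_derive (0 : R) (1 : R) (F l k)
    (k%:R * E (fun w => B l w * (V w ^+ k.-1 * Z a w))).
  by apply: is_derive_Rintegral_pow => //; exact: ap.
have F0 l k : F l k 0 = E (fun w => B l w * V w ^+ k).
  by apply: eq_Rintegral => w _; rewrite mul0r addr0.
pose L t := E (fun w => (Z u w * B s w) * (V w + t * Z a w) ^+ n.+1).
have dL : is_derive (0 : R) (1 : R) L
    (n.+1%:R * E (fun w => (Z u w * B s w) * (V w ^+ n * Z a w))).
  by apply: is_derive_Rintegral_pow => //; apply: all_momentsM => //; exact: ap.
pose K t := E (fun w => Z u w * (V w + t * Z a w) ^+ 1).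
have dK : is_derive (0 : R) (1 : R) K (cov u a).
  rewrite (_ : cov u a = 1%:R * E (fun w => Z u w * (V w ^+ 0 * Z a w))).
    exact: is_derive_Rintegral_pow.
  by rewrite mul1r; apply: eq_Rintegral => w _; rewrite expr0 mul1r.
(* the formula for s, at V + t Z_a and n + 1, for every t *)
have LE : L = (\sum_(i < size s)
      cov u (nth 0%N s i) *: F (rem (nth 0%N s i) s) n.+1)
    + n.+1%:R *: (K * F s n).
  apply/funext => t; rewrite /L.
  under eq_Rintegral do rewrite -mulrA.
  rewrite IHs; last exact: gaussian_spanD.
  rewrite !fctE /GRing.scale/= fct_sumE; congr (_ + _ * (_ * _)).
  by rewrite (big_nth 0%N) big_mkord.
have dR : is_derive (0 : R) (1 : R) L
   ((\sum_(i < size s) cov u (nth 0%N s i) *: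
       (n.+1%:R * E (fun w => B (rem (nth 0%N s i) s) w * (V w ^+ n * Z a w))))
    + n.+1%:R *: (K 0 *: (n%:R * E (fun w => B s w * (V w ^+ n.-1 * Z a w)))
                  + F s n 0 *: cov u a)).
  by rewrite LE; apply: is_deriveD.
have := is_derive_unique dL dR.
rewrite F0 /GRing.scale/= => h.
have n0 : n.+1%:R != 0 :> R by rewrite pnatr_eq0.
apply: (mulfI n0).
transitivity (n.+1%:R * E (fun w => Z u w * B s w * (V w ^+ n * Z a w))).
  congr (_ * _); apply: eq_Rintegral => w _; rewrite big_cons -/(B s w); ring.
rewrite h {h} big_cons /= eqxx.
have K0 : K 0 = E (fun w => Z u w * V w).
  by apply: eq_Rintegral => w _; rewrite mul0r addr0 expr1.
rewrite K0 -/(B s).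
have -> : E (fun w => \prod_(x <- a :: s) Z x w * V w ^+ n.-1) =
  E (fun w => B s w * (V w ^+ n.-1 * Z a w)).
  apply: eq_Rintegral => w _; rewrite big_cons -/(B s w); ring.
have -> : \sum_(x <- s) cov u x *
    E (fun w =>
      (\prod_(y <- (if a == x then s else a :: rem x s)) Z y w) * V w ^+ n) =
  \sum_(i < size s) cov u (nth 0%N s i) *
    E (fun w => B (rem (nth 0%N s i) s) w * (V w ^+ n * Z a w)).
  rewrite (big_nth 0%N) big_mkord; apply: eq_bigr => i _; congr (_ * _).
  apply: eq_Rintegral => w _.
  have xs : nth 0%N s i \in s by rewrite mem_nth.
  rewrite (perm_big (a :: rem (nth 0%N s i) s)); last first.
    by case: eqP => // ->; exact: perm_to_rem.
  by rewrite big_cons /B /=; ring.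
rewrite -/(B s).
under eq_bigr do rewrite mulrCA.
rewrite -mulr_sumr -mulrDr; congr (_ * _).
rewrite [X in _ = X + _]addrC -!addrA; congr (_ + _).
by rewrite [LHS]addrC; congr (_ + _); [exact: mulrC|exact: mulrCA].

Qed.

End GaussianProcess.

(** * Orthogonality to the events of a Gaussian variable *)

Section AnnihilatedFunctions.
Import HBNNSimple.
Context (d : measure_display) (T : measurableType d) (R : realType).
Variable mu : {measure set T -> \bar R}.
Local Notation E f := (Rintegral mu setT f).
Local Notation Rintegrable f := (mu.-integrable setT (EFin \o f)).

Lemma norm_exp_partial_sum (y : R) n :
  `|\sum_(0 <= p < n) y ^+ p / p`!%:R| <= expR `|y|.
Proof.
apply: le_trans (ler_norm_sum _ _ _) _.
apply: (@le_trans _ _ (series (exp_coeff `|y|) n)).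
  rewrite /series /=; apply: ler_sum => p _.
  by rewrite /exp_coeff /= normrM normrX normfV normr_nat.
apply: nondecreasing_cvgn_le; last exact: is_cvg_series_exp_coeff.
by apply: nondecreasing_series => p _ _; exact: exp_coeff_ge0.
Qed.

Lemma cvg_exp_partial_sum (y : R) :
  (\sum_(0 <= p < n) y ^+ p / p`!%:R) @[n --> \oo] --> expR y.
Proof. exact: is_cvg_series_exp_coeff. Qed.

(** The partial sums of the exponential series are dominated by
    [expR `|S|]. *)
Lemma Rintegral_mul_expR_eq0 (H S : T -> R) :
  measurable_fun setT H -> measurable_fun setT S ->
  Rintegrable (fun w => `|H w| * expR `|S w|) ->
  (forall p, E (fun w => H w * S w ^+ p) = 0) ->
  E (fun w => H w * expR (S w)) = 0.
Proof.
move=> mH mS iHS HS.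
have mHS p : measurable_fun setT (fun w => H w * S w ^+ p).
  by apply: measurable_funM => //; exact: measurable_funX.
have iHSp p : Rintegrable (fun w => H w * S w ^+ p).
  apply: (Rintegrable_le (mHS p) _ (RintegrableZ p`!%:R iHS)) => w.
  by rewrite normrM normrX mulrCA ler_wpM2l// le_fact_expR.
apply: (Rintegral_dominated_eq0
  (f_ := fun n w => H w * \sum_(0 <= p < n) S w ^+ p / p`!%:R) _ _ iHS).
- move=> n; apply: measurable_funM => //; apply: measurable_sum => p.
  by apply: measurable_funM => //; exact: measurable_funX.
- by apply: measurable_funM => //; exact: measurableT_comp.
- by move=> n w; rewrite normrM ler_wpM2l// norm_exp_partial_sum.
- by move=> w; apply: cvgMr; exact: cvg_exp_partial_sum.
- move=> n.
  transitivity (E (fun w => \sum_(0 <= p < n) p`!%:R^-1 * (H w * S w ^+ p))).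
    apply: eq_Rintegral => w _; rewrite mulr_sumr; apply: eq_bigr => p _.
    by rewrite mulrA mulrC.
  rewrite Rintegral_sum; last by move=> p; exact: RintegrableZ.
  by apply: big1 => p _; rewrite RintegralZl// HS mulr0.
Qed.

(** Passes from events to variables by approximating the positive and the
    negative part of [U] by simple functions of [U]. *)
Lemma Rintegral_mul_eq0 (U H : T -> R) :
  measurable_fun setT U -> Rintegrable H -> Rintegrable (fun w => U w * H w) ->
  (forall S : set R, measurable S -> E (fun w => \1_S (U w) * H w) = 0) ->
  E (fun w => U w * H w) = 0.
Proof.
move=> mU iH iUH h; have mH := Rintegrable_measurable iH.
suff pos (f : R -> R) : measurable_fun setT f -> (forall x, 0 <= f x) ->
    (forall x, f x <= `|x|) -> E (fun w => f (U w) * H w) = 0.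
  have iM (f : R -> R) : measurable_fun setT f -> (forall x, 0 <= f x) ->
      (forall x, f x <= `|x|) -> Rintegrable (fun w => f (U w) * H w).
    move=> mf f0 fx; apply: (Rintegrable_le _ _ (integrable_norm iUH)).
      by apply: measurable_funM => //; exact: measurableT_comp.
    by move=> w; rewrite /= !normrM ler_wpM2r// ger0_norm.
  have mp : measurable_fun setT (fun x : R => Num.max x 0) by exact: measurable_maxr.
  have mn : measurable_fun setT (fun x : R => Num.max (- x) 0).
    by apply: measurable_maxr => //; exact: measurableT_comp.
  have -> : E (fun w => U w * H w) =
      E (fun w => Num.max (U w) 0 * H w - Num.max (- U w) 0 * H w).
    apply: eq_Rintegral => w _; rewrite -mulrBl; congr (_ * _).
    have [u0|/ltW u0] := leP (U w) 0.
      by rewrite max_l ?oppr_ge0// sub0r opprK.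
    by rewrite max_r ?oppr_le0// subr0.
  rewrite RintegralB//.
  - rewrite (pos (fun x => Num.max x 0))// ?(pos (fun x => Num.max (- x) 0))// ?subr0//.
    + by move=> x; rewrite le_max lexx orbT.
    + by move=> x; rewrite ge_max normr_ge0 -normrN ler_norm.
    + by move=> x; rewrite le_max lexx orbT.
    + by move=> x; rewrite ge_max normr_ge0 ler_norm.
  - apply: (iM (fun x => Num.max x 0)) => // x.
      by rewrite le_max lexx orbT.
    by rewrite ge_max normr_ge0 ler_norm.
  - apply: (iM (fun x => Num.max (- x) 0)) => // x.
      by rewrite le_max lexx orbT.
    by rewrite ge_max normr_ge0 -normrN ler_norm.
move=> mf f0 fx.
have mf' : measurable_fun setT (EFin \o f) by exact/measurable_EFinP.
pose g n := nnsfun_approx measurableT mf' n.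
have f0' x : setT x -> (0 <= (EFin \o f) x)%E by rewrite lee_fin.
have gf n x : g n x <= f x.
  by rewrite -lee_fin /g nnsfun_approxE; exact: le_approx.
apply: (Rintegral_dominated_eq0 (f_ := fun n w => g n (U w) * H w)
  _ _ (integrable_norm iUH)).
- by move=> n; apply: measurable_funM => //; exact: measurableT_comp.
- by apply: measurable_funM => //; exact: measurableT_comp.
- move=> n w; rewrite /= !normrM ler_wpM2r// ger0_norm//.
  exact: le_trans (fx _).
- move=> w; apply: cvgMl.
  have := cvg_nnsfun_approx measurableT mf' f0' (x := U w) I.
  by move=> /fine_cvg.
- move=> n; under eq_Rintegral do rewrite fimfunE fsbig_finite//= mulr_suml.
  rewrite Rintegral_sum; last first.
    move=> y; apply: (Rintegrable_le _ _ (RintegrableZ `|y| (integrable_norm iH))).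
      by apply: measurable_funM => //; apply: measurable_funM => //;
        apply: measurableT_comp => //; exact: measurable_indic.
    move=> w; rewrite /= !normrM -mulrA ler_wpM2l// ler_piMl// indicE.
    by case: (_ \in _); rewrite ?normr1 ?normr0.
  apply: big1 => y _; under eq_Rintegral do rewrite -mulrA.
  rewrite RintegralZl// ?h ?mulr0//.
  apply: (Rintegrable_le _ _ (integrable_norm iH)).
    by apply: measurable_funM => //; apply: measurableT_comp => //;
      exact: measurable_indic.
  move=> w; rewrite /= normrM ler_piMl// indicE.
  by case: (_ \in _); rewrite ?normr1 ?normr0.
Qed.

End AnnihilatedFunctions.

Section MomentDeterminacy.
Context (d : measure_display) (T : measurableType d) (R : realType).
Variables (P : probability T R) (G Y : T -> R).
Local Notation E f := (Rintegral P setT f).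
Local Notation Rintegrable f := (P.-integrable setT (EFin \o f)).
Hypothesis aG : all_moments P G.
Hypothesis aY : all_moments P Y.
Hypothesis expY : Rintegrable (fun w => expR (3 / 8 * Y w ^+ 2)).
Hypothesis orthY : forall p, E (fun w => G w * Y w ^+ p) = 0.

Let i1 : Rintegrable (cst 1 : T -> R).
Proof. exact: finite_measure_integrable_cst. Qed.

Let mG : measurable_fun setT G. Proof. by case: aG. Qed.
Let mY : measurable_fun setT Y. Proof. by case: aY. Qed.

Let aYx x : all_moments P (fun w => Y w - x).
Proof. by apply: all_momentsB => //; exact: all_moments_cst. Qed.

Let mYx x : measurable_fun setT (fun w => Y w - x).
Proof. by case: (aYx x). Qed.

Lemma orth_shift_pow x p : E (fun w => G w * (Y w - x) ^+ p) = 0.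
Proof.
suff h q : E (fun w => G w * ((Y w - x) ^+ p * Y w ^+ q)) = 0.
  by rewrite -[RHS](h 0%N); apply: eq_Rintegral => w _; rewrite expr0 mulr1.
elim: p q => [|p IHp] q.
  by rewrite -[RHS](orthY q); apply: eq_Rintegral => w _; rewrite expr0 mul1r.
have a k : all_moments P (fun w => G w * ((Y w - x) ^+ p * Y w ^+ k)).
  by apply: all_momentsM => //; apply: all_momentsM; exact: all_momentsX.
transitivity (E (fun w => G w * ((Y w - x) ^+ p * Y w ^+ q.+1)
    - x * (G w * ((Y w - x) ^+ p * Y w ^+ q)))).
  apply: eq_Rintegral => w _; rewrite !exprS.
  by move: (G w) (Y w) (_ ^+ p) (_ ^+ q) => a1 a2 a3 a4; ring.
rewrite RintegralB//; [|exact: all_moments_int|exact/RintegrableZ/all_moments_int].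
by rewrite RintegralZl ?IHp ?mulr0 ?subr0//; exact: all_moments_int.
Qed.

(* The exponential moment of order 3/8 of Y^2 leaves room for a weight
   exp((Y - x)^2 / 32) in front of any polynomial: by the exponential series
   the Gaussian factor can be introduced in steps of rate 1/32. *)
Let orth_bump_step x N p :
  E (fun w => G w * (Y w - x) ^+ p * expR (- (N%:R / 32) * (Y w - x) ^+ 2)) = 0.
Proof.
elim: N p => [|N IHN] p.
  rewrite -[RHS](orth_shift_pow x p); apply: eq_Rintegral => w _.
  by rewrite mul0r oppr0 mul0r expR0 mulr1.
have mb (c : R) : measurable_fun setT (fun w => c * (Y w - x) ^+ 2).
  by apply: measurable_funM => //; exact: measurable_funX.
have mHp k : measurable_fun setT
    (fun w => G w * (Y w - x) ^+ k * expR (- (N%:R / 32) * (Y w - x) ^+ 2)).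
  apply: measurable_funM; last by apply: measurableT_comp.
  by apply: measurable_funM => //; exact: measurable_funX.
transitivity (E (fun w =>
   (G w * (Y w - x) ^+ p * expR (- (N%:R / 32) * (Y w - x) ^+ 2))
   * expR (- 32^-1 * (Y w - x) ^+ 2))).
  apply: eq_Rintegral => w _; rewrite -[RHS]mulrA -expRD; congr (_ * expR _).
  by rewrite -natr1; move: (N%:R) ((Y w - x) ^+ 2) => a b; field.
apply: Rintegral_mul_expR_eq0 => //.
- have aH : all_moments P (fun w => G w * (Y w - x) ^+ p).
    by apply: all_momentsM => //; exact: all_momentsX.
  apply: (@Rintegrable_le _ _ _ P _ (fun w => (G w * (Y w - x) ^+ p) ^+ 2 +
     expR (x ^+ 2 / 8) * expR (3 / 8 * Y w ^+ 2))).
  + apply: measurable_funM; first exact: measurableT_comp.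
    by apply: measurableT_comp => //; exact: measurableT_comp.
  + move=> w; rewrite ger0_norm ?mulr_ge0 ?expR_ge0// normrM.
    set h := G w * _; set y := Y w.
    rewrite (ger0_norm (expR_ge0 _)).
    have e1 : expR (- (N%:R / 32) * (y - x) ^+ 2) <= 1.
      by rewrite -expR0 ler_expR mulNr oppr_le0 mulr_ge0 ?sqr_ge0 ?divr_ge0.
    have e2 : expR `|- 32^-1 * (y - x) ^+ 2| ^+ 2 <=
        expR (x ^+ 2 / 8) * expR (3 / 8 * y ^+ 2).
      rewrite -expRM_natl -expRD ler_expR normrM normrN.
      rewrite (ger0_norm (sqr_ge0 _)) ger0_norm//.
      have := sqr_ge0 (y + x); have := sqr_ge0 y; nra.
    apply: (@le_trans _ _ (`|h| * expR `|- 32^-1 * (y - x) ^+ 2|)).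
      by rewrite ler_wpM2r ?expR_ge0// ler_piMr.
    apply: (@le_trans _ _ (h ^+ 2 + expR `|- 32^-1 * (y - x) ^+ 2| ^+ 2)).
      rewrite -(real_normK (num_real h)).
      have := expR_ge0 `|- 32^-1 * (y - x) ^+ 2|; have := normr_ge0 h.
      move: (`|h|) (expR _) => u v u0 v0.
      by have := sqr_ge0 (u - v); have := mulr_ge0 u0 v0; nra.
    by rewrite lerD2l.
  + apply: RintegrableD; last exact: RintegrableZ.
    by apply: all_moments_int; exact: all_momentsX.
- move=> q; transitivity (E (fun w => (- 32^-1) ^+ q *
     (G w * (Y w - x) ^+ (p + 2 * q) * expR (- (N%:R / 32) * (Y w - x) ^+ 2)))).
    apply: eq_Rintegral => w _; rewrite exprMn exprD -exprM.
    move: (G w) (_ ^+ p) (expR _) ((- _) ^+ q) (_ ^+ (2 * q)) => a1 a2 a3 a4 a5.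
    by ring.
  rewrite RintegralZl ?IHN ?mulr0//.
  have aH : all_moments P (fun w => G w * (Y w - x) ^+ (p + 2 * q)).
    by apply: all_momentsM => //; exact: all_momentsX.
  apply: (Rintegrable_le (mHp _) _ (all_moments_int (all_moments_norm aH))) => w.
  rewrite normrM ler_piMr// ger0_norm ?expR_ge0//.
  by rewrite -expR0 ler_expR mulNr oppr_le0 mulr_ge0 ?sqr_ge0 ?divr_ge0.
Qed.

Lemma orth_bump x N :
  E (fun w => G w * expR (- N%:R * (Y w - x) ^+ 2)) = 0.
Proof.
rewrite -[RHS](orth_bump_step x (N * 32) 0); apply: eq_Rintegral => w _.
by rewrite expr0 mulr1 natrM mulfK.
Qed.

(* exp(- e^{n u} / n) tends to the indicator of u <= 0, also at u = 0 *)
Let threshold (n : nat) (u : R) : R := expR (- (n.+1%:R^-1 * expR (n.+1%:R * u))).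

Let cvg_threshold (u : R) :
  threshold n u @[n --> \oo] --> (if u <= 0 then 1 else 0 : R).
Proof.
case: ifPn => [u0|].
  apply: (@squeeze_cvgr _ _ _ _ (fun n : nat => 1 - n.+1%:R^-1) (cst 1)).
  - near=> n; apply/andP; split; last first.
      by rewrite /threshold -expR0 ler_expR oppr_le0 mulr_ge0 ?expR_ge0.
    apply: le_trans (expR_ge1Dx _); rewrite lerD2l lerN2 ler_piMr//.
    by rewrite -expR0 ler_expR mulr_ge0_le0.
  - rewrite -[X in _ --> X](subr0 1); apply: cvgB; first exact: cvg_cst.
    exact: cvg_harmonic.
  - exact: cvg_cst.
rewrite -ltNge => u0.
apply: (@squeeze_cvgr _ _ _ _ (cst 0) (fun n : nat => 2 / u ^+ 2 * n.+1%:R^-1)).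
- near=> n; apply/andP; split; first exact: expR_ge0.
  have n0 : 0 < n.+1%:R :> R by [].
  have h : n.+1%:R * u ^+ 2 / 2 <= n.+1%:R^-1 * expR (n.+1%:R * u).
    rewrite ler_pdivlMl//.
    have := le_fact_expR 2 (mulr_ge0 (ltW n0) (ltW u0)).
    rewrite exprMn (_ : 2`! = 2%N)//.
    set a := expR _; set b := n.+1%:R; lra.
  have h0 : 0 < n.+1%:R * u ^+ 2 / 2 by rewrite divr_gt0 ?mulr_gt0 ?exprn_gt0.
  rewrite /threshold expRN.
  apply: (@le_trans _ _ ((n.+1%:R * u ^+ 2 / 2)^-1)); last first.
    by rewrite !invfM invrK le_eqVlt; apply/orP; left; apply/eqP; ring.
  rewrite lef_pV2 ?posrE ?expR_gt0//.
  apply: le_trans h _; apply: le_trans (expR_ge1Dx _).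
  by rewrite lerDr.
- exact: cvg_cst.
- rewrite -[X in _ --> X](mulr0 (2 / u ^+ 2)).
  by apply: cvgMr; exact: cvg_harmonic.
Unshelve. all: by end_near. Qed.

(** At [r ^+ 2 - (Y - x) ^+ 2] the threshold function is the exponential of a
    multiple of a bump, hence a limit of polynomials in that bump, whose powers
    are bumps again. *)
Lemma orth_threshold x r :
  E (fun w => G w * (if r ^+ 2 - (Y w - x) ^+ 2 <= 0 then 1 else 0)) = 0.
Proof.
have mu2 : measurable_fun setT (fun w => r ^+ 2 - (Y w - x) ^+ 2).
  by apply: measurable_funB => //; exact: measurable_funX.
have iG := all_moments_int aG.
have mth n : measurable_fun setT (threshold n).
  have m1 : measurable_fun setT (fun u : R => n.+1%:R * u) by exact: measurable_funM.
  have m2 : measurable_fun setT (fun u : R => n.+1%:R^-1 * expR (n.+1%:R * u)).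
    by apply: measurable_funM => //; apply: measurableT_comp.
  by apply: measurableT_comp => //; apply: measurableT_comp.
have th1 n u : `|threshold n u| <= 1.
  rewrite ger0_norm ?expR_ge0// -expR0 ler_expR oppr_le0.
  by rewrite mulr_ge0 ?expR_ge0.
apply: (Rintegral_dominated_eq0
  (f_ := fun n w => G w * threshold n (r ^+ 2 - (Y w - x) ^+ 2)) _ _ (integrable_norm iG)).
- by move=> n; apply: measurable_funM => //; exact: measurableT_comp (mth n) mu2.
- apply: measurable_funM => //; apply: measurable_fun_ifT => //.
  exact: measurable_fun_ler.
- by move=> n w; rewrite /= normrM ler_piMr.
- by move=> w; apply: cvgMr; exact: cvg_threshold.
- move=> n; pose c := n.+1%:R^-1 * expR (n.+1%:R * r ^+ 2).
  have c0 : 0 <= c by rewrite mulr_ge0 ?expR_ge0.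
  pose e w := expR (- n.+1%:R * (Y w - x) ^+ 2).
  have e01 w : 0 <= e w <= 1.
    rewrite expR_ge0 -expR0 ler_expR mulNr oppr_le0 mulr_ge0 ?sqr_ge0//.
  have me : measurable_fun setT e.
    apply: measurableT_comp => //; apply: measurable_funM => //.
    exact: measurable_funX.
  transitivity (E (fun w => G w * expR (- c * e w))).
    apply: eq_Rintegral => w _; rewrite /threshold; congr (_ * expR _).
    by rewrite mulrBr expRD mulNr /e /c mulNr mulrA.
  apply: Rintegral_mul_expR_eq0 => //; first exact: measurable_funM.
  + apply: (@Rintegrable_le _ _ _ P _ (fun w => expR c * `|G w|)).
    * apply: measurable_funM; first exact: measurableT_comp.
      by do 2 apply: measurableT_comp => //; exact: measurable_funM.
    * move=> w; rewrite ger0_norm ?mulr_ge0 ?expR_ge0// mulrC ler_wpM2r//.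
      case/andP: (e01 w) => e0 e1.
      by rewrite ler_expR normrM normrN !ger0_norm// ler_piMr.
    * exact/RintegrableZ/integrable_norm.
  + move=> p; transitivity (E (fun w => (- c) ^+ p *
        (G w * expR (- (p * n.+1)%:R * (Y w - x) ^+ 2)))).
      apply: eq_Rintegral => w _.
      rewrite exprMn mulrCA; congr (_ * (_ * _)).
      by rewrite /e -expRM_natl natrM mulrA mulrN.
    rewrite RintegralZl ?orth_bump ?mulr0//.
    apply: (Rintegrable_le _ _ (integrable_norm iG)).
      apply: measurable_funM => //; apply: measurableT_comp => //.
      by apply: measurable_funM => //; exact: measurable_funX.
    move=> w; rewrite /= normrM ler_piMr// ger0_norm ?expR_ge0//.
    by rewrite -expR0 ler_expR mulNr oppr_le0 mulr_ge0 ?sqr_ge0.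
Qed.

Let orth_itv (u v : R) : E (fun w => \1_(`]u, v[%classic) (Y w) * G w) = 0.
Proof.
have [uv|vu] := ltP u v; last first.
  rewrite set_itv_ge -?leNgt//; under eq_Rintegral do rewrite indic0 mul0r.
  by rewrite Rintegral_cst// mul0r.
have iG := all_moments_int aG.
pose x := (u + v) / 2; pose r := (v - u) / 2.
have EG : E G = 0.
  rewrite -[RHS](orthY 0); apply: eq_Rintegral => w _.
  by rewrite expr0 mulr1.
transitivity (E (fun w => G w -
    G w * (if r ^+ 2 - (Y w - x) ^+ 2 <= 0 then 1 else 0))).
  apply: eq_Rintegral => w _; rewrite mulrC -[X in _ = X - _]mulr1 -mulrBr.
  congr (_ * _); rewrite indicE mem_setE in_itv /=.
  rewrite subr_le0.
  have -> : (r ^+ 2 <= (Y w - x) ^+ 2) = ~~ (u < Y w < v).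
    have e : (Y w - x) ^+ 2 - r ^+ 2 = (Y w - u) * (Y w - v).
      by rewrite /x /r; field.
    rewrite -subr_ge0 e; apply/idP/idP.
      apply: contraTN => /andP[h1 h2]; rewrite -ltNge nmulr_llt0 ?subr_gt0//.
      by rewrite subr_lt0.
    rewrite negb_and -!leNgt => /orP[h|h].
      by rewrite mulr_le0// subr_le0// (le_trans h)// ltW.
    by rewrite mulr_ge0// subr_ge0// (le_trans _ h)// ltW.
  by case: (_ && _); rewrite /= ?subr0 ?subrr.
rewrite RintegralB//.
  by rewrite EG orth_threshold subrr.
apply: (Rintegrable_le _ _ (integrable_norm iG)).
  apply: measurable_funM => //; apply: measurable_fun_ifT => //.
  apply: measurable_fun_ler => //; apply: measurable_funB => //.
  exact: measurable_funX.
by move=> w /=; rewrite normrM ler_piMr//; case: ifP; rewrite ?normr0 ?normr1.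
Qed.

(** The polynomials in [Y] determine its sigma-algebra because [Y] has a
    square-exponential moment: [orth_threshold] yields the open intervals, which
    generate the Borel sets and are closed under intersection. *)
Lemma orth_indic (B : set R) : measurable B ->
  E (fun w => \1_B (Y w) * G w) = 0.
Proof.
have iG := all_moments_int aG.
have iB (A : set R) : measurable A -> Rintegrable (fun w => \1_A (Y w) * G w).
  move=> mA; apply: (Rintegrable_le _ _ (integrable_norm iG)).
    by apply: measurable_funM => //; apply: measurableT_comp => //;
      exact: measurable_indic.
  move=> w; rewrite /= normrM ler_piMl// indicE.
  by case: (_ \in _); rewrite ?normr1 ?normr0.
have ET : E (fun w => \1_[set: R] (Y w) * G w) = 0.
  rewrite -[RHS](orthY 0); apply: eq_Rintegral => w _.
  by rewrite indicT expr0 mulr1 mul1r.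
move=> mB; have mE := @RGenOpens.measurableE R.
apply: (@dynkin_induction _ (measurableTypeR R) (@RGenOpens.G R)
  (fun A => E (fun w => \1_A (Y w) * G w) = 0) mE _ _ _ _ _ B).
- move=> _ _ [a [b ->]] [a' [b' ->]].
  exists (Num.max a a'), (Num.min b b'); apply/seteqP; split=> z /=.
    by rewrite !in_itv/= gt_max lt_min => -[/andP[-> ->] /andP[-> ->]].
  by rewrite !in_itv/= gt_max lt_min => /andP[/andP[-> ->] /andP[-> ->]].
- exact: ET.
- by move=> _ [a [b ->]]; exact: orth_itv.
- move=> S mS /= ES.
  transitivity (E (fun w => \1_[set: R] (Y w) * G w - \1_S (Y w) * G w)).
    apply: eq_Rintegral => w _; rewrite -mulrBl; congr (_ * _).
    by rewrite !indicE in_setT in_setC; case: (_ \in S); rewrite ?subrr ?subr0.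
  by rewrite RintegralB ?ET ?ES ?subrr//; exact: iB.
- move=> F mF tF EF /=.
  have sum1 y n : \sum_(0 <= j < n) \1_(F j) y =
      (`[< exists2 k, (k < n)%N & F k y >])%:R :> R.
    case: asboolP => [[k kn Fk]|nF] /=.
      rewrite (bigD1_seq k)/= ?mem_index_iota ?iota_uniq//.
      rewrite indicE mem_set// big1 ?addr0// => j jk.
      rewrite indicE memNset// => Fj.
      by move/trivIsetP: tF => /(_ j k I I jk)/seteqP[/(_ y)/(_ (conj Fj Fk))].
    rewrite big_nat big1// => j jn; rewrite indicE memNset// => Fj.
    by apply: nF; exists j.
  apply: (Rintegral_dominated_eq0
    (f_ := fun n w => (\sum_(0 <= j < n) \1_(F j) (Y w)) * G w) _ _ (integrable_norm iG)).
  + move=> n; apply: measurable_funM => //; apply: measurable_sum => j.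
    by apply: measurableT_comp => //; apply: measurable_indic; exact: mF.
  + apply: measurable_funM => //; apply: measurableT_comp => //.
    by apply: measurable_indic; apply: bigcup_measurable => k _; exact: mF.
  + move=> n w; rewrite /= normrM ler_piMl// sum1.
    by case: asbool; rewrite ?normr1 ?normr0.
  + move=> w; apply: cvgMl; apply: cvg_near_cst.
    have [[k _ Fk]|nF] := pselect ((\bigcup_k F k) (Y w)).
      near=> n; rewrite sum1 indicE mem_set; last by exists k.
      by rewrite asboolT//; exists k => //; near: n; exact: nbhs_infty_gt.
    near=> n; rewrite sum1 indicE memNset//.
    by rewrite asboolF// => -[k _ Fk]; apply: nF; exists k.
  + move=> n; under eq_Rintegral do rewrite mulr_suml.
    rewrite Rintegral_sum; last by move=> j; apply: iB; exact: mF.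
    by apply: big1 => j _; exact: EF.
- suff : (@RGenOpens.G R).-sigma.-measurable B by [].
  by rewrite -mE.
Unshelve. all: by end_near. Qed.

End MomentDeterminacy.

(** * Covariances of the Markov process *)

Section MarkovCovariance.
Context (d : measure_display) (T : measurableType d) (R : realType).
Variables (P : probability T R) (Z : nat -> {RV P >-> R}).
Local Notation E f := (Rintegral P setT f).
Local Notation Rintegrable f := (P.-integrable setT (EFin \o f)).
Local Notation cov x y := (E (fun w => Z x w * Z y w)).
Hypothesis gaussZ : gaussian_process Z.
Hypothesis meanZ : forall n, E (Z n) = 0.
Hypothesis varZ : forall n, cov n n = 1.

(** By [gaussian_ibp_pow] this reduces to the case [p = 1], in which the
    coefficient of [Z n] was chosen to make the two terms cancel. *)
Lemma residual_orth_pow l n p :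
  E (fun w => (Z l w - cov l n * Z n w) * Z n w ^+ p) = 0.
Proof.
have aZ x := all_moments_Z gaussZ x.
have i1 : Rintegrable (cst 1 : T -> R) by exact: finite_measure_integrable_cst.
have aX x : all_moments P (fun w => Z x w * Z n w ^+ p).
  by apply: all_momentsM => //; exact: all_momentsX.
transitivity (E (fun w => Z l w * Z n w ^+ p - cov l n * (Z n w * Z n w ^+ p))).
  by apply: eq_Rintegral => w _; rewrite mulrBl mulrA.
rewrite RintegralB//; [|exact: all_moments_int|exact/RintegrableZ/all_moments_int].
rewrite RintegralZl//; last exact: all_moments_int.
have sZ := gaussian_spanZ Z n.
rewrite !(gaussian_ibp_pow gaussZ meanZ _ _ sZ) varZ mul1r mulrCA.
exact: subrr.
Qed.

Lemma residual_orth_indic l n (B : set R) : measurable B ->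
  E (fun w => \1_B (Z n w) * (Z l w - cov l n * Z n w)) = 0.
Proof.
have aZ x := all_moments_Z gaussZ x.
apply: orth_indic.
- by apply: all_momentsB => //; exact: all_momentsZ.
- exact: aZ.
- apply: (span_exp_sqr gaussZ meanZ (gaussian_spanZ Z n)).
  by rewrite -[RHS](varZ n); apply: eq_Rintegral => w _; rewrite expr2.
- exact: residual_orth_pow.
Qed.

Lemma Rintegral_indic_prob (C : set T) : measurable C -> E (\1_C) = fine (P C).
Proof. by move=> mC; rewrite /Rintegral integral_indic// setIT. Qed.

Lemma indic_preimage (f : T -> R) (S : set R) w :
  \1_(f @^-1` S) w = \1_S (f w) :> R.
Proof.
by rewrite !indicE.
Qed.

(** The conditional probability [Y] of the event, given the past, is a function
    of [Z n], so that E(1_A(Z_(n+1)) G) = E(Y G) = 0. A version [Y] need not be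
    bounded, so everything is restricted to the event [`|Y| <= M], which lies in
    the sigma-algebra of [Z n], before [M] tends to infinity. *)
Lemma markov_residual_orth l n (A : set R) : markov_process Z -> (l <= n)%N ->
  measurable A ->
  E (fun w => \1_A (Z n.+1 w) * (Z l w - cov l n * Z n w)) = 0.
Proof.
move=> markovZ ln mA.
have aZ x := all_moments_Z gaussZ x.
pose G w : R := Z l w - cov l n * Z n w.
have aG : all_moments P G by apply: all_momentsB => //; exact: all_momentsZ.
have iG := all_moments_int aG; have [mG _] := aG.
have [Y [[iY FY intY] [_ sY _]]] := markovZ n A mA.
have mY := Rintegrable_measurable iY.
have mW : measurable_fun setT (fun w => \1_A (Z n.+1 w) : R).
  by apply: measurableT_comp => //; exact: measurable_indic.
have mI (M : R) : measurable [set x : R | `|x| <= M].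
  rewrite (_ : [set x : R | `|x| <= M] = `[- M, M]%classic)//.
  by apply/seteqP; split=> x /=; rewrite in_itv/= ler_norml.
pose t (M x : R) : R := \1_[set x : R | `|x| <= M] x.
have mt M : measurable_fun setT (t M) by exact: measurable_indic.
have t01 M x : 0 <= t M x <= 1.
  by rewrite /t indicE; case: (_ \in _); rewrite ?lexx ler01.
have A01 (x : R) : 0 <= (\1_A x : R) <= 1.
  by rewrite indicE; case: (_ \in _); rewrite ?lexx ler01.
have norm01 (a b g : R) : 0 <= a <= 1 -> 0 <= b <= 1 -> `|a * g * b| <= `|g|.
  move=> /andP[a0 a1] /andP[b0 b1]; rewrite mulrAC normrM ler_piMl//.
  by rewrite ger0_norm ?mulr_ge0// mulr_ile1.
have trunc (M : R) : E (fun w => (t M (Y w) * G w) * \1_A (Z n.+1 w)) = 0.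
  pose U1 w := Y w * t M (Y w).
  pose U2 w := t M (Y w) * G w.
  have mU1 : measurable_fun setT U1.
    by apply: measurable_funM => //; exact: measurableT_comp.
  have mU2 : measurable_fun setT U2.
    by apply: measurable_funM => //; exact: measurableT_comp.
  have iU1 : Rintegrable (fun w => U1 w * G w).
    apply: (Rintegrable_le _ _ (RintegrableZ `|M| (integrable_norm iG))).
      exact: measurable_funM.
    move=> w; rewrite /= normrM ler_wpM2r// /U1 /t indicE.
    have [/set_mem/= h|_] := boolP (_ \in _); last by rewrite mulr0 normr0.
    by rewrite mulr1 (le_trans h)// ler_norm.
  have iU2 : Rintegrable (fun w => U2 w * \1_A (Z n.+1 w)).
    apply: (Rintegrable_le _ _ (integrable_norm iG)); first exact: measurable_funM.
    by move=> w; apply: norm01.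
  (* the truncated conditional probability is a function of Z n *)
  have E1 : E (fun w => U1 w * G w) = 0.
    apply: Rintegral_mul_eq0 => // S mS.
    have [B mB BE] : exists2 B : set R, measurable B & Z n @^-1` B = U1 @^-1` S.
      have mS' : measurable ((fun x : R => x * t M x) @^-1` S).
        rewrite -[X in measurable X]setTI.
        by apply: measurable_funM.
      by have [B mB BE] := sY _ mS'; exists B => //; rewrite -[LHS]setTI BE.
    rewrite -[RHS](residual_orth_indic l n mB); apply: eq_Rintegral => w _.
    by rewrite -!indic_preimage BE.
  (* the truncated residual is measurable with respect to the past *)
  have E2 : E (fun w => U2 w * (\1_A (Z n.+1 w) - Y w)) = 0.
    have iUY : Rintegrable (fun w => U2 w * Y w).
      move: iU1; rewrite (_ : (fun w => U1 w * G w) = (fun w => U2 w * Y w))//.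
      by apply/funext => w; rewrite /U1 /U2; ring.
    have iA : Rintegrable (fun w => \1_A (Z n.+1 w)).
      apply: (Rintegrable_le mW (g := cst 1)).
        by move=> w; rewrite indicE; case: (_ \in _); rewrite ?normr1 ?normr0.
      exact: finite_measure_integrable_cst.
    apply: Rintegral_mul_eq0 => //.
    - exact: RintegrableB.
    - rewrite (_ : (fun w => _) = (fun w => U2 w * \1_A (Z n.+1 w) - U2 w * Y w)).
        exact: RintegrableB.
      by apply/funext => w; rewrite mulrBr.
    move=> S mS; pose B := U2 @^-1` S.
    have FB : g_sigma_preimage (fun i : 'I_n.+1 => Z i : T -> R) B.
      pose F0 := \big[setU/set0]_(i < n.+1)
        preimage_set_system setT (Z i : T -> R) measurable.
      pose T' := g_sigma_algebraType F0.
      have mZ' i : (i <= n)%N -> @measurable_fun _ _ T' R setT (Z i).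
        move=> i_n _ S' mS'; rewrite setTI; apply: sub_sigma_algebra.
        rewrite /F0 (bigD1 (Ordinal (i_n : (i < n.+1)%N)))//=; left.
        by exists S' => //; rewrite setTI.
      have mY' : @measurable_fun _ _ T' R setT Y.
        by move=> _ S' mS'; rewrite setTI; exact: FY.
      have mU2' : @measurable_fun _ _ T' R setT U2.
        apply: measurable_funM; first exact: measurableT_comp.
        apply: measurable_funB; first exact: mZ'.
        by apply: measurable_funM => //; exact: mZ'.
      by have := mU2' measurableT S mS; rewrite setTI.
    have mB : measurable B.
      by rewrite /B -[X in measurable X]setTI; exact: mU2.
    have mAB : measurable (Z n.+1 @^-1` A).
      by rewrite -[X in measurable X]setTI; exact: measurable_funP.
    transitivity (E (\1_(Z n.+1 @^-1` A `&` B) : T -> R) - E (Y \_ B)).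
      rewrite -RintegralB//.
      + apply: eq_Rintegral => w _.
        rewrite -[RHS]/(\1_(Z n.+1 @^-1` A `&` B) w - (Y \_ B) w) patchE indicI /=.
        rewrite mulrBr -!indic_preimage -/B !indicE.
        by case: (w \in B); rewrite ?mul1r ?mulr1 ?mul0r ?mulr0.
      + by apply: integrable_indic => //; exact: measurableI.
      + apply: (Rintegrable_le _ _ (integrable_norm iY)).
          by apply/(measurable_restrictT Y) => //; exact: measurable_funTS.
        move=> w; rewrite -[X in `|X|]/((Y \_ B) w) patchE /=.
        by case: ifP => // _; rewrite -[point]/(0 : R) normr0.
    rewrite Rintegral_indic_prob; last exact: measurableI.
    by rewrite -Rintegral_mkcond /Rintegral intY// subrr.
  transitivity (E (fun w => U2 w * (\1_A (Z n.+1 w) - Y w) + U1 w * G w)).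
    by apply: eq_Rintegral => w _; rewrite /U1 /U2; ring.
  rewrite RintegralD ?E1 ?E2 ?addr0//.
  rewrite (_ : (fun w => _) = (fun w => U2 w * \1_A (Z n.+1 w) - U1 w * G w)).
    exact: RintegrableB.
  by apply/funext => w; rewrite /U1 /U2; ring.
apply: (Rintegral_dominated_eq0
  (f_ := fun M w => (t M%:R (Y w) * G w) * \1_A (Z n.+1 w)) _ _ (integrable_norm iG)).
- move=> M; apply: measurable_funM => //; apply: measurable_funM => //.
  exact: measurableT_comp.
- exact: measurable_funM.
- by move=> M w; apply: norm01.
- move=> w; apply: cvg_near_cst; near=> M.
  rewrite /t indicE mem_set ?mul1r 1?mulrC//=.
  by near: M; exact: nbhs_infty_ger.
- by move=> M; exact: trunc.
Unshelve. all: by end_near. Qed.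

End MarkovCovariance.

Section MarkovCovarianceDecay.
Context (d : measure_display) (T : measurableType d) (R : realType).
Variables (P : probability T R) (Z : nat -> {RV P >-> R}).
Local Notation E f := (Rintegral P setT f).
Local Notation cov x y := (E (fun w => Z x w * Z y w)).
Hypothesis gaussZ : gaussian_process Z.
Hypothesis meanZ : forall n, E (Z n) = 0.
Hypothesis varZ : forall n, cov n n = 1.
Hypothesis markovZ : markov_process Z.
Hypothesis statZ : stationary Z.

Lemma covC x y : cov x y = cov y x.
Proof. by apply: eq_Rintegral => w _; rewrite mulrC. Qed.

Lemma markov_cov l n : (l <= n)%N -> cov n.+1 l = cov l n * cov n.+1 n.
Proof.
move=> ln; have aZ x := all_moments_Z gaussZ x.
have iZ x y : P.-integrable setT (EFin \o (fun w => Z x w * Z y w)).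
  by apply: all_moments_int; exact: all_momentsM.
pose G w : R := Z l w - cov l n * Z n w.
have aG : all_moments P G by apply: all_momentsB => //; exact: all_momentsZ.
have : E (fun w => Z n.+1 w * G w) = 0.
  apply: Rintegral_mul_eq0 => //.
  - exact: all_moments_int.
  - by apply: all_moments_int; exact: all_momentsM.
  - by move=> S mS; exact: markov_residual_orth.
rewrite (_ : E (fun w => Z n.+1 w * G w) =
    E (fun w => Z n.+1 w * Z l w - cov l n * (Z n.+1 w * Z n w))); last first.
  by apply: eq_Rintegral => w _; rewrite /G mulrBr mulrCA.
rewrite RintegralB//; last exact: RintegrableZ.
by rewrite RintegralZl// => /eqP; rewrite subr_eq0 => /eqP.
Qed.

(** Equality of the laws of the pairs gives equality of the laws of the
    products. *)
Lemma stationary_cov n : cov n.+1 n = cov 1%N 0%N.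
Proof.
have aZ x := all_moments_Z gaussZ x.
have mZZ x y : measurable_fun setT (fun w => Z x w * Z y w).
  by have [] := all_momentsM (aZ x) (aZ y).
pose X x y : {mfun T >-> R} :=
  HB.pack (fun w => Z x w * Z y w) (isMeasurableFun.Build _ _ _ _ _ (mZZ x y)).
apply: (@eq_law_expectation _ _ _ P (X n.+1 n) (X 1%N 0%N)); last first.
  by apply: all_moments_int; exact: all_momentsM.
move=> A mA.
pose t : 2.-tuple nat := [tuple 1; 0]%N.
pose f (u : 2.-tuple R) : R := tnth u ord0 * tnth u (lift ord0 ord0).
have mf : measurable_fun setT f.
  by apply: measurable_funM; exact: measurable_tnth.
have mB : measurable (f @^-1` A).
  by rewrite -[X in measurable X]setTI; exact: mf.
have := statZ t n mB.
rewrite (_ : _ @^-1` (f @^-1` A) = X n.+1 n @^-1` A); last first.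
  by apply/seteqP; split=> w; rewrite /= /f !tnth_mktuple.
rewrite (_ : _ @^-1` (f @^-1` A) = X 1%N 0%N @^-1` A) => [->//|].
by apply/seteqP; split=> w; rewrite /= /f !tnth_mktuple.
Qed.

Lemma cov_pow x y : cov x y = cov 1%N 0%N ^+ `|x%:Z - y%:Z|%N.
Proof.
have h l m : cov (l + m)%N l = cov 1%N 0%N ^+ m.
  elim: m => [|m IHm]; first by rewrite addn0 varZ expr0.
  by rewrite addnS markov_cov ?leq_addr// stationary_cov covC IHm exprSr.
have [/subnKC <-|/ltnW/subnKC <-] := leqP x y.
  by rewrite covC h; congr (_ ^+ _); lia.
by rewrite h; congr (_ ^+ _); lia.
Qed.

End MarkovCovarianceDecay.

(** * Estimates for functions satisfying the Wick recursion *)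

Lemma size_rem_mem (y : nat) (s : seq nat) :
  y \in s -> size s = (size (rem y s)).+1 :> nat.
Proof. by move=> /perm_to_rem /perm_size. Qed.

Lemma sum_le_size_mul (R : numDomainType) (s : seq nat) (F : nat -> R) (c : R) :
  (forall y, y \in s -> F y <= c) -> \sum_(y <- s) F y <= (size s)%:R * c.
Proof.
move=> Fc; apply: (le_trans (y := \sum_(y <- s) c)).
  by rewrite big_seq [leRHS]big_seq ler_sum.
by rewrite big_const_seq count_predT iter_addr addr0 mulr_natl.
Qed.

(** If oddly many entries are at most [n], every pairing of the list has a pair
    straddling [n]; summing over [n] therefore bounds the total length of any
    pairing from below. *)
Definition parity_sum (N : nat) (s : seq nat) : nat :=
  (\sum_(n < N) odd (count (fun x => x <= n) s))%N.

Lemma parity_sum_perm N s t : perm_eq s t -> parity_sum N s = parity_sum N t.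
Proof. by move=> st; apply: eq_bigr => n _; rewrite (permP st). Qed.

Lemma sum_window N x y :
  (\sum_(n < N) ((x <= n) && (n < y)) = minn N y - x)%N.
Proof.
elim: N => [|N IHN]; first by rewrite big_ord0 min0n.
by rewrite big_ord_recr /= IHN; case: (leqP x N); case: (ltnP N y) => /=; lia.
Qed.

(** Joining [x] and [y] changes the parity at [n] only if [n] lies between
    them. *)
Lemma parity_sum_cons2 N x y s :
  (parity_sum N [:: x, y & s] <= `|x%:Z - y%:Z| + parity_sum N s)%N.
Proof.
wlog xy : x y / (x <= y)%N.
  move=> h; have [|/ltnW yx] := leqP x y; first exact: h.
  rewrite (parity_sum_perm N (t := [:: y, x & s])).
    by rewrite distnC; exact: h.
  by rewrite -cat1s -[X in perm_eq _ X]cat1s -(cat1s y) -(cat1s x s) perm_catCA.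
have w : (\sum_(n < N) ((x <= n) && (n < y)) <= y - x)%N.
  by rewrite sum_window leq_sub2r// geq_minr.
rewrite distnEr//; apply: leq_trans (leq_add w (leqnn _)).
rewrite -big_split; apply: leq_sum => n _ /=.
rewrite !oddD !oddb; case: (odd _); case: (leqP x n); case: (leqP y n) => //=; lia.
Qed.

Definition doubled (s : seq nat) : seq nat := flatten [seq [:: x; x] | x <- s].
Arguments doubled : simpl never.

Lemma doubled_cons x s : doubled (x :: s) = [:: x, x & doubled s].
Proof. by []. Qed.

Lemma size_doubled s : size (doubled s) = (size s).*2.
Proof. by elim: s => // x s IHs; rewrite doubled_cons /= IHs. Qed.

Lemma mem_doubled s : doubled s =i s.
Proof.
by move=> y; elim: s => // x s IHs; rewrite doubled_cons !inE IHs orbA orbb.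
Qed.

(** [M s] plays the role of the moment of the variables indexed by [s], and [r]
    that of the covariance. *)
Section WickRecursion.
Context (R : numDomainType) (M : seq nat -> R) (r : nat -> nat -> R) (b : R).
Hypothesis M_nil : M [::] = 1.
Hypothesis M_cons : forall x s, M (x :: s) = \sum_(y <- s) r x y * M (rem y s).
Hypothesis M_perm : forall s t, perm_eq s t -> M s = M t.

Lemma wick_odd s : odd (size s) -> M s = 0.
Proof.
have [n] := ubnP (size s); elim: n s => // n IHn [|x s] //= sn os.
rewrite M_cons big_seq big1// => y ys.
have e := size_rem_mem ys.
have -> : M (rem y s) = 0; last by rewrite mulr0.
by apply: IHn; move: sn os; rewrite e /=; move: (size (rem y s)) => k; lia.
Qed.

Hypothesis r_diag : forall x, r x x = 1.
Hypothesis b01 : 0 <= b <= 1.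
Hypothesis r_le : forall x y, `|r x y| <= b ^+ `|x%:Z - y%:Z|%N.

(** By [parity_sum_cons2] the factor [r x y] pays for the part of the parity sum
    that is lost on removing [x] and [y]. *)
Lemma wick_bound N s : `|M s| <= (size s)`!%:R * b ^+ parity_sum N s.
Proof.
have [n] := ubnP (size s); elim: n s => // n IHn [|x s] /= sn.
  by rewrite M_nil normr1 fact0 mul1r /parity_sum big1.
have b0 : 0 <= b by case/andP: b01.
rewrite M_cons; apply: le_trans (ler_norm_sum _ _ _) _.
apply: (le_trans (y := (size s)%:R *
    ((size s).-1`!%:R * b ^+ parity_sum N (x :: s)))); last first.
  rewrite mulrA ler_wpM2r ?exprn_ge0// -natrM ler_nat.
  by case: (size s) => [|m]//=; rewrite -factS leq_fact//.
apply: sum_le_size_mul => y ys; have sz := size_rem_mem ys.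
have -> : (size s).-1 = size (rem y s) by move: sz => /= ->.
rewrite normrM; apply: le_trans (ler_pM _ _ (r_le x y) (IHn _ _)) _ => //.
  by move: sz sn => /=; lia.
rewrite mulrCA ler_wpM2l ?ler0n// -exprD ler_wiXn2l//; first by case/andP: b01.
have -> : parity_sum N (x :: s) = parity_sum N [:: x, y & rem y s].
  by apply: parity_sum_perm; rewrite perm_cons perm_to_rem.
exact: parity_sum_cons2.
Qed.

Lemma wick_bound_fact s : `|M s| <= (size s)`!%:R.
Proof.
have := wick_bound 0 s.
by rewrite /parity_sum big_ord0 expr0 mulr1.
Qed.

(** Every pairing of a concatenation that does not split as a pairing of each
    half contains a pair of length at least the distance [e] of the halves. *)
Lemma wick_split e s t :
  (forall x y, x \in s -> y \in t -> (e <= `|x%:Z - y%:Z|)%N) ->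
  `|M (s ++ t) - M s * M t| <= (size s + size t)`!%:R * b ^+ e.
Proof.
have [n] := ubnP (size s); elim: n s => // n IHn [|x s] /= sn st.
  by rewrite M_nil mul1r subrr normr0 mulr_ge0// exprn_ge0//; case/andP: b01.
have b0 : 0 <= b by case/andP: b01.
have be0 : 0 <= b ^+ e by exact: exprn_ge0.
have b1 : b <= 1 by case/andP: b01.
rewrite 2!M_cons big_cat /=.
set A := \sum_(y <- s) _; set B := \sum_(y <- t) _.
rewrite addrAC; apply: le_trans (ler_normD _ _) _.
have -> : A = \sum_(y <- s) r x y * M (rem y s ++ t).
  rewrite /A big_seq [RHS]big_seq; apply: eq_bigr => y ys; congr (_ * _).
  apply: M_perm; rewrite -(perm_cons y).
  rewrite -cat_cons (perm_trans _ (_ : perm_eq (s ++ t) _))//.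
    by rewrite perm_sym perm_to_rem// mem_cat ys.
  by rewrite perm_cat2r perm_to_rem.
rewrite mulr_suml -sumrB.
set m := (size s + size t)%N.
apply: (le_trans (y := (size s)%:R * (m.-1`!%:R * b ^+ e) +
    (size t)%:R * (m.-1`!%:R * b ^+ e))).
  apply: lerD; apply: le_trans (ler_norm_sum _ _ _) _;
    apply: sum_le_size_mul => y ys; have sz := size_rem_mem ys.
    rewrite -mulrA -mulrBr normrM.
    apply: le_trans (_ : 1 * ((size (rem y s) + size t)`!%:R * b ^+ e) <= _).
      apply: ler_pM => //.
        by apply: le_trans (r_le _ _) _; exact: exprn_ile1.
      apply: IHn => [|z w /mem_rem zs wt].
        by move: sn; rewrite sz; move: (size (rem y s)) => p; lia.
      by apply: st => //; rewrite inE zs orbT.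
    rewrite mul1r ler_wpM2r// ler_nat; apply: leq_fact.
    by rewrite /m sz.
  rewrite normrM mulrC; apply: ler_pM => //.
    apply: le_trans (wick_bound_fact _) _; rewrite ler_nat; apply: leq_fact.
    have yst : y \in s ++ t by rewrite mem_cat ys orbT.
    have := size_rem_mem yst.
    by rewrite size_cat /m => ->.
  apply: le_trans (r_le _ _) _; apply: ler_wiXn2l => //.
  by apply: st; rewrite ?inE ?eqxx.
rewrite -mulrDl -natrD -/m mulrA -natrM ler_wpM2r// ler_nat.
rewrite addSn -/m factS mulSn.
by case: m => [|m] //; rewrite [m.+1.-1]/= -factS leq_addr.
Qed.

(** Every pairing of the doubled list other than the one joining each entry with
    its own copy contains a pair of length at least [e]. *)
Lemma wick_squares e s :
  pairwise (fun x y => e <= `|x%:Z - y%:Z|)%N s ->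
  `|M (doubled s) - 1| <= (size s).*2`!%:R * b ^+ e.
Proof.
have b0 : 0 <= b by case/andP: b01.
have be0 : 0 <= b ^+ e by exact: exprn_ge0.
have b1 : b <= 1 by case/andP: b01.
elim: s => [_|x s IHs].
  by rewrite M_nil subrr normr0 mulr_ge0.
rewrite pairwise_cons => /andP[/allP xs /IHs{}IHs].
have remx : rem x (x :: doubled s) = doubled s by rewrite /= eqxx.
rewrite doubled_cons M_cons big_cons remx r_diag mul1r.
rewrite addrAC; apply: le_trans (ler_normD _ _) _.
apply: (le_trans (y := (size s).*2`!%:R * b ^+ e +
   (size (doubled s))%:R * ((size s).*2`!%:R * b ^+ e))).
  apply: lerD => //; apply: le_trans (ler_norm_sum _ _ _) _.
  apply: sum_le_size_mul => y ys.
  rewrite normrM mulrC; apply: ler_pM => //.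
    apply: le_trans (wick_bound_fact _) _; rewrite ler_nat; apply: leq_fact.
    have yst : y \in x :: doubled s by rewrite inE ys orbT.
    have := size_rem_mem yst.
by rewrite [size (_ :: _)]/= size_doubled => -[<-].
  apply: le_trans (r_le _ _) _; apply: ler_wiXn2l => //.
  by apply: xs; rewrite -mem_doubled.
rewrite size_doubled; set m := (size s).*2.
rewrite -[X in X + _]mul1r -mulrDl nat1r mulrA -natrM -factS ler_wpM2r//.
by rewrite ler_nat leq_fact// /= doubleS -/m.
Qed.

End WickRecursion.

(** * The index sequences of the statement *)

Lemma minseq_le (s : seq nat) (m x : nat) :
  minseq s = Some m -> x \in s -> (m <= x)%N.
Proof.
case: s => // y s [<-]; elim: s y => [|z s IHs] y.
  by rewrite mem_seq1 => /eqP ->.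
rewrite !in_cons /= geq_min => /or3P[xy|/eqP ->|xs].
- by rewrite IHs ?orbT// in_cons xy.
- by rewrite leqnn.
- by rewrite (IHs y) ?orbT// in_cons xs orbT.
Qed.

Lemma nondecr_le k i l m : nondecr k i ->
  (1 <= l)%N -> (l <= m)%N -> (m <= k)%N -> (i l <= i m)%N.
Proof.
move=> ndi l1; elim: m => [|m IHm]; first by rewrite leqn0 => /eqP ->.
rewrite leq_eqVlt => /predU1P[->//|]; rewrite ltnS => lm mk.
apply: leq_trans (IHm lm (ltnW mk)) _.
by apply: ndi; rewrite (leq_trans l1 lm).
Qed.

(** For an increasing list the parity at [n] is odd exactly on the gaps between
    the entries number 2 j - 1 and 2 j, apart from the tail of a list of odd
    length. *)
Lemma gap_sum_le_parity k i N : nondecr k i ->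
  (forall l, (1 <= l <= k)%N -> (i l <= N)%N) ->
  (gap_sum k i <= parity_sum N [seq i l | l <- iota 1 k])%N.
Proof.
have [m] := ubnP k; elim: m k i => // m IHm [|[|k]] i km ndi iN.
- by rewrite /gap_sum big_geq.
- by rewrite /gap_sum big_geq.
pose i2 l := i l.+2.
have ge := @nondecr_le _ _ _ _ ndi.
have -> : gap_sum k.+2 i = (i 2 - i 1 + gap_sum k i2)%N.
  rewrite /gap_sum big_ltn_cond//=; congr addn; rewrite /i2.
  case: (k) => [|k']; first by rewrite !big_geq.
  rewrite big_ltn_cond//=.
  rewrite (_ : 3%N = (1 + 2)%N)// -[k'.+3]addn2 big_addn addnK.
  by apply: eq_big => l; rewrite addn2 /= ?negbK.
have -> : [seq i l | l <- iota 1 k.+2] =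
    [:: i 1%N, i 2%N & [seq i2 l | l <- iota 1 k]].
  by rewrite /= (iotaDl 2 1 k) -map_comp.
have w : (i 2 - i 1 <= \sum_(n < N) ((i 1 <= n) && (n < i 2)))%N.
  by rewrite sum_window (minn_idPr (iN 2%N isT)).
apply: leq_trans (leq_add w (IHm k i2 _ _ _)) _.
- by rewrite -ltnS; exact: ltnW.
- by move=> l /andP[l1 lk]; apply: ndi; rewrite !ltnS.
- by move=> l /andP[l1 lk]; apply: iN; rewrite !ltnS.
rewrite -big_split; apply: leq_sum => n _ /=.
have [yn|ny] := leqP (i 2%N) n.
  rewrite andbF add0n (leq_trans (ge 1%N 2%N isT isT isT) yn).
  by rewrite !oddD !oddb /= negbK.
rewrite (_ : count _ _ = 0%N); first by case: (i 1%N <= n)%N.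
apply/eqP; rewrite -leqn0 leqNgt -has_count; apply/hasPn => z /mapP[l].
rewrite mem_iota => /andP[l1 lk] ->; rewrite -ltnNge (leq_trans ny)//.
by apply: ge => //; rewrite !ltnS; move: lk; rewrite add1n ltnS.
Qed.

(** Consecutive odd positions realise the minimum, since the sequence is
    nondecreasing; for even [k] the last odd position is [k.-1], which is why
    [l.+2 < k] leaves none of them out. *)
Lemma odd_gap_min_pairwise k i e : nondecr k i -> ~~ odd k ->
  odd_gap_min k i = Some e ->
  pairwise (fun x y => e <= `|x%:Z - y%:Z|)%N
    [seq i l | l <- iota 1 k & odd l].
Proof.
move=> ndi ek gap; rewrite pairwise_map.
apply: (@sub_in_pairwise _ [pred l | (1 <= l <= k)%N && odd l] ltn).
- move=> l l' /andP[/andP[l1 lk] ol] /andP[/andP[l1' lk'] ol'] /= ll'.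
  have l2l' : (l.+2 <= l')%N.
    by rewrite ltn_neqAle ll' andbT; apply: contraTneq ol' => <-; rewrite /= ol.
  have l2k : (l.+2 < k)%N.
    rewrite ltn_neqAle (leq_trans l2l' lk') andbT.
    by apply: contraNneq ek => <-; rewrite /= negbK.
  have m1 : (e <= i l.+2 - i l)%N.
    apply: (minseq_le gap); apply: map_f.
    by rewrite mem_filter ol l2k mem_iota l1 add1n ltnS lk.
  have m2 : (i l.+2 <= i l')%N by apply: (nondecr_le ndi).
  have m3 : (i l <= i l.+2)%N.
    by apply: (nondecr_le ndi) => //; [rewrite -addn2 leq_addr|exact: ltnW].
  by lia.
- apply/allP => l; rewrite mem_filter mem_iota add1n ltnS.
  by move=> /andP[ol /andP[l1 lk]] /=; rewrite l1 lk ol.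
- rewrite -(sorted_pairwise ltn_trans).
  by apply: sorted_filter; [exact: ltn_trans|exact: iota_ltn_sorted].
Qed.

Lemma odd_gap_min_None k i : ~~ odd k -> odd_gap_min k i = None ->
  (size [seq i l | l <- iota 1 k & odd l] <= 1)%N.
Proof.
by case: k => [//|[//|[//|[//|k]]]] _; rewrite /odd_gap_min /minseq /=.
Qed.

Lemma prod_doubled (R : comNzRingType) (F : nat -> R) s :
  \prod_(x <- doubled s) F x = \prod_(x <- s) F x ^+ 2.
Proof.
elim: s => [|x s IHs]; first by rewrite !big_nil.
by rewrite doubled_cons !big_cons IHs mulrA expr2.
Qed.

(** * The moment estimates *)

Local Open Scope ereal_scope.

Theorem lemma3p5 (d : measure_display) (T : measurableType d) (R : realType)
    (P : probability T R) (Z : nat -> {RV P >-> R})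
    (hstat : stationary Z) (hgauss : gaussian_process Z)
    (hmarkov : markov_process Z)
    (hmean : forall n, 'E_P[Z n] = 0) (hvar : forall n, 'V_P[Z n] = 1)
    (hnd : nondegenerate_process Z) (k : nat) :
  exists C b : R, (0 < C)%R /\ (0 <= b < 1)%R /\
    forall i j : nat -> nat, nondecr k i -> nondecr k j ->
    [/\ ~~ odd k -> `|'E_P[mixed Z k i]| <= (C * b ^+ gap_sum k i)%:E,
        odd k -> `|'E_P[mixed Z k i]| = 0,
        `|'E_P[(fun w => mixed Z k i w * mixed Z k j w)%R]
          - 'E_P[mixed Z k i] * 'E_P[mixed Z k j]|
          <= (C * powo b (dist_min k i j))%:E
      & ~~ odd k -> `|'E_P[mixed_sq Z k i] - 1|
          <= (C * powo b (odd_gap_min k i))%:E].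
Proof.
pose E (f : T -> R) : R := Rintegral P setT f.
have meanE n : E (Z n) = 0%R.
  by have := hmean n; rewrite unlock /E /Rintegral => ->.
have aZ x : all_moments P (Z x) := all_moments_Z hgauss x.
have ExpE f : P.-integrable setT (EFin \o f) -> 'E_P[f] = (E f)%:E.
  by move=> i_f; rewrite unlock /E /Rintegral fineK//; exact: integrable_fin_num.
pose cov x y : R := E (fun w => Z x w * Z y w)%R.
have iZZ x y : P.-integrable setT (EFin \o (fun w => Z x w * Z y w)%R).
  by apply: all_moments_int; exact: all_momentsM.
have covE x y : covariance P (Z x) (Z y) = (cov x y)%:E.
  rewrite unlock !hmean -ExpE//; congr expectation.
  by apply/funext => w /=; rewrite !fctE /= !subr0.
have varE n : cov n n = 1%R.
  by have := hvar n; rewrite /variance covE => -[].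
pose b := `|cov 1%N 0%N|%R.
have b01 : (0 <= b < 1)%R.
  rewrite normr_ge0 /=; have := hnd.
  rewrite /nondegenerate_process covE -lte_fin abse_EFin.
  by rewrite /b (covC Z 1%N 0%N : cov _ _ = cov _ _).
have b01' : (0 <= b <= 1)%R by case/andP: b01 => -> /ltW.
pose M (s : seq nat) : R := E (fun w => \prod_(x <- s) Z x w)%R.
have aprod (s : seq nat) : all_moments P (fun w => \prod_(x <- s) Z x w)%R.
  by apply: all_moments_prod => //; exact: finite_measure_integrable_cst.
have M_nil : M [::] = 1%R.
  rewrite /M /E; under eq_Rintegral do rewrite big_nil.
  exact: Rintegral_prob_cst.
have M_cons x s : M (x :: s) = (\sum_(y <- s) cov x y * M (rem y s))%R.
  have := gaussian_ibp hgauss meanE x s 0 (gaussian_span0 Z).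
  rewrite mul0r addr0 => h; rewrite /M /E.
  transitivity (E (fun w => Z x w * (\prod_(y <- s) Z y w * 0 ^+ 0)))%R.
    by apply: eq_Rintegral => w _; rewrite big_cons expr0 mulr1.
  rewrite [LHS]h; apply: eq_bigr => y _; congr (_ * _)%R.
  by apply: eq_Rintegral => w _; rewrite expr0 mulr1.
have M_perm s t : perm_eq s t -> M s = M t.
  by move=> st; apply: eq_Rintegral => w _; exact: perm_big.
have cov_le x y : (`|cov x y| <= b ^+ `|x%:Z - y%:Z|%N)%R.
  by rewrite /cov /E (cov_pow hgauss meanE varE hmarkov hstat) normrX.
pose l_ (i : nat -> nat) := [seq i l | l <- iota 1 k].
have sz i : size (l_ i) = k by rewrite size_map size_iota.
have mixedE i : mixed Z k i = (fun w => \prod_(x <- l_ i) Z x w)%R.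
  by apply/funext => w; rewrite /mixed /l_ big_map /index_iota subn1.
have Emixed i : 'E_P[mixed Z k i] = (M (l_ i))%:E.
  by rewrite mixedE ExpE//; exact: all_moments_int.
exists ((k + k)`!%:R)%R, b; split; first by rewrite ltr0n fact_gt0.
split=> // i j ndi ndj.
have b0 n : (0 <= b ^+ n)%R by apply: exprn_ge0; case/andP: b01.
split.
- move=> _; rewrite Emixed abse_EFin lee_fin.
  (* any bound for all the i l will do *)
  pose N := (\sum_(1 <= l < k.+1) i l)%N.
  apply: le_trans (wick_bound M_nil M_cons b01' cov_le N _) _.
  rewrite sz; apply: ler_pM => //.
    by rewrite ler_nat leq_fact// leq_addr.
  apply: ler_wiXn2l; [by case/andP: b01'|by case/andP: b01'|].
  apply: gap_sum_le_parity => // l /andP[l1 lk].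
  by rewrite /N (bigD1_seq l)/= ?mem_index_iota ?iota_uniq ?l1//= leq_addr.
- by move=> ok; rewrite Emixed (wick_odd M_cons) ?sz// abse0.
- rewrite !Emixed.
  have -> : 'E_P[(fun w => mixed Z k i w * mixed Z k j w)%R] = (M (l_ i ++ l_ j))%:E.
    rewrite !mixedE ExpE; last by apply: all_moments_int; exact: all_momentsM.
    by congr EFin; apply: eq_Rintegral => w _; rewrite big_cat.
  rewrite -EFinM -EFinB abse_EFin lee_fin.
  case dE : (dist_min k i j) => [e|].
    have := @wick_split R M cov b M_nil M_cons M_perm b01' cov_le e (l_ i) (l_ j).
    rewrite !sz; apply => _ _ /mapP[n nk ->] /mapP[m mk ->].
    by apply: (minseq_le dE); apply/allpairsP; exists (n, m).
  have k0 : k = 0%N by move: dE; rewrite /dist_min; case: (k).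
  by rewrite /l_ k0 /= M_nil mulr1 subrr normr0 mulr0.
- move=> ek; pose q := [seq i l | l <- iota 1 k & odd l].
  have -> : 'E_P[mixed_sq Z k i] = (M (doubled q))%:E.
    rewrite ExpE.
      congr EFin; apply: eq_Rintegral => w _.
      by rewrite /mixed_sq prod_doubled big_map big_filter /index_iota subn1.
    rewrite (_ : mixed_sq Z k i = (fun w => \prod_(x <- doubled q) Z x w)%R).
      exact: all_moments_int.
    apply/funext => w.
    by rewrite /mixed_sq prod_doubled big_map big_filter /index_iota subn1.
  rewrite -EFinB abse_EFin lee_fin.
  case gE : (odd_gap_min k i) => [e|].
    have := wick_squares M_nil M_cons varE b01' cov_le
      (odd_gap_min_pairwise ndi ek gE).
    move=> /le_trans; apply; apply: ler_pM => //.
    rewrite ler_nat leq_fact// -addnn leq_add// size_map size_filter;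
      by rewrite (leq_trans (count_size _ _))// size_iota.
  rewrite mulr0; have := odd_gap_min_None ek gE; rewrite -/q.
  case: q => [|x [|//]] _; first by rewrite M_nil subrr normr0.
  rewrite /doubled /= !M_cons big_seq1 /= eqxx M_nil varE mulr1.
  by rewrite subrr normr0.
Qed.
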